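(* Let $1\le p<\infty$, $\varrho\in[1,2)$ and $\alpha\in(\frac14,\frac1{2\varrho})$. Let $X=(X^1,\dots,X^d)$ be a $d$-dimensional continuous, centred Gaussian process on $[0,T]$ with independent components, defined on a probability space $(\Omega,\mathcal F,\mathbb P)$, with $X_0=x_0=0$, such that for some $M<\infty$, for every $i\in\{1,\ldots,d\}$ and all $0\le s\le t\le T$, $$\|R_{X^i}\|_{\varrho;[s,t]^2}\le M|t-s|^{1/\varrho}.$$ Fix $n\in\mathbb{N}$ and let $X^{\pi_n}$ denote the piecewise linear interpolation of $X$ along the partition $\pi_n$ of $[0,T]$. Set $\widehat X^{\pi_n}_t:=(t,X^{\pi_n}_t)$, $t\in[0,T]$. (i) Let $f\colon\widehat{\mathcal C}^{\pi_n}\to\mathbb{R}$ be Borel measurable with $f(\widehat X^{\pi_n})\in L^p(\Omega)$. Then for every $\varepsilon>0$ there exists a linear functional $\boldsymbol\ell$ of the form $\boldsymbol\ell(\widehat{\mathbb X}^{\pi_n}_T)=\sum_{|I|\le N}\ell_I\langle e_I,\widehat{\mathbb X}^{\pi_n}_T\rangle$, for some $N\in\mathbb{N}_0$ and $\ell_I\in\mathbb{R}$, such that $$\mathbb E\bigl[|f(\widehat X^{\pi_n})-\boldsymbol\ell(\widehat{\mathbb X}^{\pi_n}_T)|^p\bigr]<\varepsilon^p.$$ (ii) Let $f\in L^p(\Lambda_T^{\pi_n};\nu_n)$, where $\nu_n:=(dt\otimes\mu_{\widehat X^{\pi_n}})\circ\phi^{-1}$. Then for every $\varepsilon>0$ there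 exists a linear functional $\boldsymbol\ell$ of the form $\boldsymbol\ell(\widehat{\mathbb X}^{\pi_n}_t)=\sum_{|I|\le N}\ell_I\langle e_I,\widehat{\mathbb X}^{\pi_n}_t\rangle$, for some $N\in\mathbb{N}_0$ and $\ell_I\in\mathbb{R}$, such that $$\mathbb E\Bigl[\int_0^T\bigl|f(\widehat X^{\pi_n}_{[0,t]})-\boldsymbol\ell(\widehat{\mathbb X}^{\pi_n}_t)\bigr|^p\,dt\Bigr]<\varepsilon^p.$$
   Context: Covariance. $R_{X^i}(s,t)=\mathbb E[X^i_sX^i_t]$. For intervals $J,J'\subset[0,T]$ the two-dimensional $\varrho$-variation is $\|R_{X^i}\|_{\varrho;J\times J'}:=\bigl(\sup\sum_{[u,v]\in\mathcal P,\,[u',v']\in\mathcal P'}|\mathbb E[(X^i_v-X^i_u)(X^i_{v'}-X^i_{u'})]|^\varrho\bigr)^{1/\varrho}$, the supremum being over all partitions $\mathcal P$ of $J$ and $\mathcal P'$ of $J'$. Partitions. $(\pi_n)_{n\in\mathbb{N}}$ is a nested sequence of partitions of $[0,T]$ ($\pi_n\subset\pi_{n+1}$) with mesh $|\pi_n|\to0$. Path space. For a partition $\pi=\{0=t_0<\cdots<t_n=T\}$ and $x\colon\pi\to\mathbb{R}^d$ with $x(0)=x_0$ (fixed initial value), $x^\pi\colon[0,T]\to\mathbb{R}^d$ is the piecewise linear interpolation of $x$ along $\pi$, and $\widehat x^\pi_t=(t,x^\pi_t)\in\mathbb{R}^{d+1}$. $\widehat{\mathcal C}^\pi$ is the set of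 all such $\widehat x^\pi$, with metric $d_{\alpha'}(Y,Z):=\sup_{0\le s<t\le T}|(Y_t-Y_s)-(Z_t-Z_s)|/|t-s|^{\alpha'}$ for some fixed $0\le\alpha'<\alpha$ ($|\cdot|$ Euclidean norm). Stopped paths. $\Lambda_T^\pi:=\bigcup_{t\in[0,T]}\{\widehat x^\pi_{[0,t]}:\widehat x^\pi\in\widehat{\mathcal C}^\pi\}$, where $\widehat x^\pi_{[0,t]}$ is the restriction of $\widehat x^\pi$ to $[0,t]$, with metric $d_{\Lambda,\alpha'}(\widehat x^\pi_{[0,t]},\widehat y^\pi_{[0,s]}):=|t-s|+d_{\alpha'}(\widehat x^{\pi,t},\widehat y^{\pi,s})$, where $\widehat x^{\pi,t}_u=(u,x^\pi_{u\wedge t})$, $u\in[0,T]$. Both spaces carry their Borel $\sigma$-algebras. $\phi\colon[0,T]\times\widehat{\mathcal C}^\pi\to\Lambda_T^\pi$ is the (continuous) map $\phi(t,\widehat x^\pi)=\widehat x^\pi_{[0,t]}$, and $\mu_{\widehat X^{\pi_n}}$ is the law of $\widehat X^{\pi_n}$ on $\widehat{\mathcal C}^{\pi_n}$. Signature. The coordinates of $\mathbb{R}^{d+1}$ are indexed by $0,\ldots,d$, index $0$ being time, with canonical basis $e_0,\dots,e_d$. Multi-indices $I=(i_1,\ldots,i_k)$ have entries in $\{0,\ldots,d\}$, $|I|=k$, $e_I=e_{i_1}\otimes\cdots\otimes e_{i_k}$. $\widehat{\mathbb X}^{\pi_n}_t\in T((\mathbb{R}^{d+1}))=\prod_{k\ge0}(\mathbb{R}^{d+1})^{\otimes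 k}$ is the signature of $\widehat X^{\pi_n}$ on $[0,t]$: $\langle e_I,\widehat{\mathbb X}^{\pi_n}_t\rangle=\int_{0<u_1<\cdots<u_k<t}d\widehat X^{\pi_n,i_1}_{u_1}\cdots d\widehat X^{\pi_n,i_k}_{u_k}$ (pathwise Riemann–Stieltjes integrals), $\langle e_\emptyset,\cdot\rangle=1$. *)

(* Defs.v *)
From HB Require Import structures.
From mathcomp Require Import all_boot all_order all_algebra.
From mathcomp Require Import all_classical all_reals all_analysis.
From mathcomp Require Import ring.

Set Implicit Arguments.
Unset Strict Implicit.
Unset Printing Implicit Defensive.

Import Order.TTheory GRing.Theory Num.Theory.
Import numFieldNormedType.Exports.

Local Open Scope classical_set_scope.
Local Open Scope ring_scope.

(* A partition {a = t_0 < ... < t_n = b} of [a, b] is, as in the library's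
   [itv_partition], the list [:: t_1; ...; t_n] without its first point. *)
Section partitions.
Context {R : realType}.
Implicit Types (a b : R) (p : seq R).

Definition pnode a p (k : nat) : R := nth a (a :: p) k.

Definition mesh a p : R :=
  \big[Num.max/0]_(k < size p) (pnode a p k.+1 - pnode a p k).

End partitions.

Section gaussian_processes.
Context {R : realType} {dO : measure_display} {Omega : measurableType dO}.
Context {d : nat}.
Variable P : probability Omega R.
Implicit Types X : R -> Omega -> 'rV[R]_d.

(* [normal_prob m 0] is not the Dirac mass at m in the library. *)
Definition gaussian_law (m s : R) (A : set R) : \bar R :=
  if s == 0 then \d_m A else normal_prob m s A.

Definition gaussian_var (Y : Omega -> R) : Prop :=
  measurable_fun setT Y /\
  exists m s : R, forall A, measurable A -> pushforward P Y A = gaussian_law m s A.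

Definition gaussian_process (T : R) X : Prop :=
  forall (k : nat) (t c : 'I_k -> R) (i : 'I_k -> 'I_d),
    (forall j, 0 <= t j <= T) ->
    gaussian_var (fun w => \sum_(j < k) c j * X (t j) w 0 (i j)).

Definition centred_process (T : R) X : Prop :=
  forall (t : R) (i : 'I_d), 0 <= t <= T ->
    ('E_P[fun w => X t w 0%R i] = 0)%E.

(* The sigma-algebra generated by the i-th component of X over [0, T]. *)
Definition component_sigma (T : R) X (i : 'I_d) : set (set Omega) :=
  <<s [set A | exists t : R, 0 <= t <= T /\
         exists2 B : set R, measurable B & A = (fun w => X t w 0 i) @^-1` B] >>.

(* Families over a subset of 'I_d are covered by taking A i = setT elsewhere. *)
Definition independent_components (T : R) X : Prop :=
  forall A : 'I_d -> set Omega, (forall i, component_sigma T X i (A i)) ->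
    P (\bigcap_i A i) = (\prod_(i < d) fine (P (A i)))%:E.

Definition variation2 (rho : R) (Y : R -> Omega -> R) (s t s' t' : R) : \bar R :=
  (ereal_sup [set x | exists p p' : seq R,
     [/\ itv_partition s t p, itv_partition s' t' p' &
      x = (\sum_(k < size p) \sum_(l < size p')
             `| 'E_P[(fun w => (Y (pnode s p k.+1) w - Y (pnode s p k) w) *
                        (Y (pnode s' p' l.+1) w - Y (pnode s' p' l) w))%R] |
               `^ rho)%E ]] `^ rho^-1)%E.

End gaussian_processes.

Section riemann_stieltjes_signature.
Context {R : realType}.

Definition is_rs_integral (f g : R -> R) (a b I : R) : Prop :=
  forall e : R, 0 < e -> exists2 delta : R, 0 < delta &
    forall (p : seq R) (xi : nat -> R),
      itv_partition a b p -> mesh a p < delta ->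
      (forall k, (k < size p)%N -> pnode a p k <= xi k <= pnode a p k.+1) ->
      `|\sum_(k < size p) f (xi k) * (g (pnode a p k.+1) - g (pnode a p k)) - I|
        < e.

Definition rs_integral (f g : R -> R) (a b : R) : R :=
  xget 0 [set I | is_rs_integral f g a b I].

Context {d : nat}.

Fixpoint iterated_integral (Y : R -> 'rV[R]_d) (J : seq 'I_d) (t : R) : R :=
  if J is i :: J' then
    rs_integral (fun u => iterated_integral Y J' u) (fun u => Y u 0 i) 0 t
  else 1.

(* <e_I, S(Y)_t>: the last letter of I is the outermost integrator. *)
Definition signature (Y : R -> 'rV[R]_d) (I : seq 'I_d) (t : R) : R :=
  iterated_integral Y (rev I) t.

Definition sig_functional (N : nat) (l : seq 'I_d -> R)
    (Y : R -> 'rV[R]_d) (t : R) : R :=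
  \sum_(k < N.+1) \sum_(I : k.-tuple 'I_d) l I * signature Y I t.

End riemann_stieltjes_signature.

Section euclidean.
Context {R : realType} {n : nat}.
Implicit Types u v : 'rV[R]_n.

(* The library's norm on 'rV[R]_n is the sup norm. *)
Definition enorm u : R := Num.sqrt (\sum_i u 0 i ^+ 2).

Lemma enorm0 : enorm 0 = 0.
Proof.
by rewrite /enorm big1 ?sqrtr0// => i _; rewrite mxE expr0n.
Qed.

Lemma enormN u : enorm (- u) = enorm u.
Proof. by congr Num.sqrt; apply: eq_bigr => i _; rewrite mxE sqrrN. Qed.

Lemma enorm_ge0 u : 0 <= enorm u.
Proof. exact: sqrtr_ge0. Qed.

Lemma sqr_enorm u : enorm u ^+ 2 = \sum_i u 0 i ^+ 2.
Proof. by rewrite sqr_sqrtr// sumr_ge0// => i _; rewrite sqr_ge0. Qed.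

Lemma cauchy_schwarz u v : \sum_i u 0 i * v 0 i <= enorm u * enorm v.
Proof.
have h : (\sum_i u 0 i * v 0 i) ^+ 2 <= (enorm u * enorm v) ^+ 2.
  rewrite exprMn !sqr_enorm -subr_ge0.
  suff: 0 <= ((\sum_i u 0 i ^+ 2) * (\sum_i v 0 i ^+ 2) -
              (\sum_i u 0 i * v 0 i) ^+ 2) *+ 2 by rewrite pmulrn_lge0.
  have -> : ((\sum_i u 0 i ^+ 2) * (\sum_i v 0 i ^+ 2) -
              (\sum_i u 0 i * v 0 i) ^+ 2) *+ 2 =
            \sum_i \sum_j (u 0 i * v 0 j - u 0 j * v 0 i) ^+ 2.
    rewrite mulr2n {1}[X in X + _ = _](_ : _ =
      \sum_i \sum_j (u 0 i ^+ 2 * v 0 j ^+ 2 -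
        (u 0 i * v 0 i) * (u 0 j * v 0 j))); last first.
      rewrite expr2 !mulr_suml -sumrB; apply: eq_bigr => i _.
      by rewrite !mulr_sumr -sumrB.
    rewrite [X in _ + X = _](_ : _ =
      \sum_i \sum_j (u 0 j ^+ 2 * v 0 i ^+ 2 -
        (u 0 i * v 0 i) * (u 0 j * v 0 j))); last first.
      rewrite expr2 [(\sum_i u 0 i ^+ 2) * _]mulrC !mulr_suml -sumrB.
      apply: eq_bigr => i _; rewrite !mulr_sumr -sumrB.
      by apply: eq_bigr => j _; rewrite [v 0 i ^+ 2 * _]mulrC.
    rewrite -big_split/=; apply: eq_bigr => i _.
    rewrite -big_split/=; apply: eq_bigr => j _.
    by ring.
  by apply: sumr_ge0 => i _; apply: sumr_ge0 => j _; rewrite sqr_ge0.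
apply: le_trans (ler_norm _) _.
rewrite -ler_sqr ?nnegrE ?normr_ge0 ?mulr_ge0 ?enorm_ge0//.
by rewrite -normrX ger0_norm// sqr_ge0.
Qed.

Lemma enormD u v : enorm (u + v) <= enorm u + enorm v.
Proof.
rewrite -ler_sqr ?nnegrE ?addr_ge0 ?enorm_ge0// sqrrD !sqr_enorm.
rewrite (eq_bigr (fun i => u 0 i ^+ 2 + (u 0 i * v 0 i) *+ 2 + v 0 i ^+ 2)).
  rewrite 2!big_split/= lerD2r lerD2l sumrMnl.
  by rewrite lerMn2r /= cauchy_schwarz.
by move=> i _; rewrite mxE sqrrD.
Qed.

End euclidean.

Section holder_distance.
Context {R : realType} {n : nat}.
Variables T a : R.
Implicit Types Y Z : R -> 'rV[R]_n.

(* The supremum is taken in \bar R; on piecewise linear paths it is finite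
   when 0 <= a <= 1. *)
Definition holder_dist Y Z : \bar R :=
  ereal_sup [set x | exists s t : R, 0 <= s /\ s < t /\ t <= T /\
    x = (enorm ((Y t - Y s) - (Z t - Z s)) / `|t - s| `^ a)%:E].

Lemma holder_dist_ball Y (e : R) : 0 < e -> (holder_dist Y Y < e%:E)%E.
Proof.
move=> e0; apply: (@le_lt_trans _ _ 0%E); last by rewrite lte_fin.
apply: ge_ereal_sup => _ [s [t [_ [_ [_ ->]]]]].
by rewrite subrr enorm0 mul0r.
Qed.

Lemma holder_dist_sym Y Z : holder_dist Y Z = holder_dist Z Y.
Proof.
by congr ereal_sup; apply/seteqP; split => _ [s [t [s0 [st [tT ->]]]]];
  exists s, t; do !split => //; rewrite -enormN opprB.
Qed.

Lemma holder_dist_triangle Y W Z (e1 e2 : R) :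
  (holder_dist Y W < e1%:E)%E -> (holder_dist W Z < e2%:E)%E ->
  (holder_dist Y Z < (e1 + e2)%:E)%E.
Proof.
have lower (x : \bar R) (e : R) : (x < e%:E)%E ->
    exists2 e' : R, e' < e & (x <= e'%:E)%E.
  case: x => [x||]//; first by rewrite lte_fin; exists x.
  by exists (e - 1); rewrite ?leNye// ltrBlDr ltrDl.
move=> /lower[e1' lt1 h1] /lower[e2' lt2 h2].
apply: (@le_lt_trans _ _ (e1' + e2')%:E); last by rewrite lte_fin ltrD.
apply: ge_ereal_sup => _ [s [t [s0 [st [tT ->]]]]].
have bound U V (e : R) : (holder_dist U V <= e%:E)%E ->
    enorm ((U t - U s) - (V t - V s)) / `|t - s| `^ a <= e.
  move=> h; rewrite -lee_fin; apply: le_trans h; apply: ereal_sup_ubound.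
  by exists s, t; do !split.
rewrite lee_fin; apply: le_trans (lerD (bound _ _ _ h1) (bound _ _ _ h2)).
rewrite -mulrDl ler_wpM2r ?invr_ge0 ?powR_ge0//.
apply: le_trans (enormD _ _); rewrite le_eqVlt; apply/orP; left; apply/eqP.
by congr enorm; rewrite addrA subrK.
Qed.

End holder_distance.

(* Coordinate 0 of R^(d+1) is time. *)
Definition time_ext {R : realType} {d : nat} (x : R -> 'rV[R]_d) :
    R -> 'rV[R]_d.+1 :=
  fun t => \row_i (if unlift ord0 i is Some j then x t 0 j else t).

Definition space_part {R : realType} {d : nat} (v : 'rV[R]_d.+1) : 'rV[R]_d :=
  \row_j v 0 (lift ord0 j).

Fixpoint lin_interp {R : realType} {d : nat} (x : R -> 'rV[R]_d)
    (a : R) (p : seq R) (t : R) : 'rV[R]_d :=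
  if p is b :: p' then
    if t <= b then x a + ((t - a) / (b - a)) *: (x b - x a)
    else lin_interp x b p' t
  else x a.

(* A path on [0, t] is represented by a function on R that is 0 off [0, t];
   only the values of x on the partition matter in [lin_path x]. *)
Definition lin_path {R : realType} {d : nat} (T : R) (p : seq R)
    (x : R -> 'rV[R]_d) : R -> 'rV[R]_d.+1 :=
  time_ext (lin_interp x 0 p) \_ `[0, T].

Definition lin_paths {R : realType} {d : nat} (T : R) (p : seq R)
    (x0 : 'rV[R]_d) : set (R -> 'rV[R]_d.+1) :=
  [set lin_path T p x | x in [set x | x 0 = x0]].

(* \bigcup_t of the restrictions to [0, t], each restriction being the pair of
   its domain's endpoint t and a function on R that is 0 off [0, t]. *)
Definition stopped_paths {R : realType} {d : nat} (T : R) (p : seq R)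
    (x0 : 'rV[R]_d) : set (R * (R -> 'rV[R]_d.+1)) :=
  \bigcup_(t in `[0, T])
    [set (t, g \_ `[0, t]) | g in lin_paths T p x0].

(* The exponent a is a parameter of the types because it fixes their metrics. *)
Record Chat {R : realType} {d : nat} (T : {posnum R}) (a : R) (p : seq R)
    (x0 : 'rV[R]_d) := MkChat {
  path_of : R -> 'rV[R]_d.+1;
  path_ofP : lin_paths T%:num p x0 path_of }.

Record Lambda {R : realType} {d : nat} (T : {posnum R}) (a : R) (p : seq R)
    (x0 : 'rV[R]_d) := MkLambda {
  stopped_of : R * (R -> 'rV[R]_d.+1);
  stopped_ofP : stopped_paths T%:num p x0 stopped_of }.

Section path_spaces.
Context {R : realType} {d : nat}.
Variables (T : {posnum R}) (a : R) (p : seq R) (x0 : 'rV[R]_d).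

Local Notation C := (Chat T a p x0).
Local Notation L := (Lambda T a p x0).

Definition path_along (x : R -> 'rV[R]_d) (hx : x 0 = x0) : C :=
  @MkChat R d T a p x0 (lin_path T%:num p x)
    (ex_intro2 _ _ x hx erefl : lin_paths T%:num p x0 _).

Definition Chat_dist (Y Z : C) : \bar R :=
  holder_dist T%:num a (path_of Y) (path_of Z).

Let Chat_ball (Y : C) (e : R) : set C := [set Z | (Chat_dist Y Z < e%:E)%E].

Let Chat_ball_center Y (e : R) : 0 < e -> Chat_ball Y e Y.
Proof. exact: holder_dist_ball. Qed.

Let Chat_ball_sym Y Z (e : R) : Chat_ball Y e Z -> Chat_ball Z e Y.
Proof. by rewrite /Chat_ball /Chat_dist/= holder_dist_sym. Qed.

Let Chat_ball_triangle Y W Z (e1 e2 : R) :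
  Chat_ball Y e1 W -> Chat_ball W e2 Z -> Chat_ball Y (e1 + e2) Z.
Proof. exact: holder_dist_triangle. Qed.

HB.instance Definition _ := gen_eqMixin C.
HB.instance Definition _ := gen_choiceMixin C.
HB.instance Definition _ := isPointed.Build C (@path_along (cst x0) erefl).
HB.instance Definition _ :=
  hasNbhs.Build C (nbhs_ (entourage_ Chat_ball)).
HB.instance Definition _ := @Nbhs_isPseudoMetric.Build R C
  (entourage_ Chat_ball) erefl Chat_ball
  Chat_ball_center Chat_ball_sym Chat_ball_triangle erefl.

(* The path u |-> (u, x_(u /\ t)) attached to the restriction of (., x) to
   [0, t]. *)
Definition frozen (z : R * (R -> 'rV[R]_d.+1)) : R -> 'rV[R]_d.+1 :=
  time_ext (fun u => space_part (z.2 (Num.min u z.1))).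

Definition Lambda_dist (z z' : L) : \bar R :=
  (`|(stopped_of z).1 - (stopped_of z').1|%:E +
   holder_dist T%:num a (frozen (stopped_of z)) (frozen (stopped_of z')))%E.

Let Lambda_ball (z : L) (e : R) : set L :=
  [set z' | (Lambda_dist z z' < e%:E)%E].

Let Lambda_ball_center z (e : R) : 0 < e -> Lambda_ball z e z.
Proof.
by move=> e0; rewrite /Lambda_ball /Lambda_dist/= subrr normr0 add0e
  holder_dist_ball.
Qed.

Let Lambda_ball_sym z z' (e : R) : Lambda_ball z e z' -> Lambda_ball z' e z.
Proof. by rewrite /Lambda_ball /Lambda_dist/= holder_dist_sym distrC. Qed.

Let Lambda_ball_triangle y w z (e1 e2 : R) :
  Lambda_ball y e1 w -> Lambda_ball w e2 z -> Lambda_ball y (e1 + e2) z.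
Proof.
rewrite /Lambda_ball /Lambda_dist/= -!lteBrDl// -!EFinB.
move=> /holder_dist_triangle h /h; move/lt_le_trans; apply.
rewrite lee_fin addrACA lerD2l -opprD lerN2.
by rewrite -[X in `|X|](subrKA (stopped_of w).1) ler_normD.
Qed.

Let point_stopped :
  stopped_paths T%:num p x0 (0, lin_path T%:num p (cst x0) \_ `[0, 0]).
Proof.
exists 0; first by rewrite /= in_itv/= lexx/=.
by exists (lin_path T%:num p (cst x0)) => //; exists (cst x0).
Qed.

HB.instance Definition _ := gen_eqMixin L.
HB.instance Definition _ := gen_choiceMixin L.
HB.instance Definition _ := isPointed.Build L (MkLambda a point_stopped).
HB.instance Definition _ :=
  hasNbhs.Build L (nbhs_ (entourage_ Lambda_ball)).
HB.instance Definition _ := @Nbhs_isPseudoMetric.Build R L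
  (entourage_ Lambda_ball) erefl Lambda_ball
  Lambda_ball_center Lambda_ball_sym Lambda_ball_triangle erefl.

Definition clamp (t : R) : R := Num.min (Num.max t 0) T%:num.

Lemma clamp_itv t : clamp t \in `[0, T%:num].
Proof.
by rewrite /clamp in_itv/= le_min ge_min lexx orbT andbT le_max lexx orbT ge0.
Qed.

Definition phi (z : R * C) : L :=
  @MkLambda R d T a p x0
    (clamp z.1, path_of z.2 \_ `[0, clamp z.1])
    (ex_intro2 _ _ (clamp z.1) (clamp_itv z.1)
      (ex_intro2 _ _ (path_of z.2) (path_ofP z.2) erefl)).

End path_spaces.

Notation borel E := (g_sigma_algebraType (@open E)).

Section laws.
Context {R : realType} {d : nat}.
Variables (T : {posnum R}) (a : R) (p : seq R) (x0 : 'rV[R]_d).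
Context {dO : measure_display} {Omega : measurableType dO}.
Variables (P : probability Omega R) (X : R -> Omega -> 'rV[R]_d).
Hypothesis X0 : forall w, X 0 w = x0.

Definition Xhat (w : Omega) : borel (Chat T a p x0) :=
  path_along T a p (X0 w : (fun t => X t w) 0 = x0).

Definition law_Xhat : set (borel (Chat T a p x0)) -> \bar R :=
  pushforward P Xhat.

(* (dt (x) law of Xhat) o phi^-1.  dt is Lebesgue measure restricted to [0, T], so the values of [phi] at
   times outside [0, T] do not matter. *)
Definition law_stopped : set (borel (Lambda T a p x0)) -> \bar R :=
  pushforward
    (mrestr lebesgue_measure (measurable_itv `[0%R, (T%:num)%R]) \x law_Xhat)%E
    (@phi R d T a p x0 :
       (R * borel (Chat T a p x0))%type ->
       borel (Lambda T a p x0)).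

End laws.
Arguments Xhat {R d} T a p {x0 dO Omega X} X0 w.
Arguments law_Xhat {R d} T a p {x0 dO Omega} P {X} X0.
Arguments law_stopped {R d} T a p {x0 dO Omega} P {X} X0.

(* [Lfun mu r%:E] for a set function mu not bundled as a measure. *)
Definition in_Lp {R : realType} {dE : measure_display} {E : measurableType dE}
    (mu : set E -> \bar R) (r : R) (f : E -> R) : Prop :=
  measurable_fun setT f /\ (\int[mu]_y (`|f y| `^ r)%:E < +oo)%E.

(* Main.v *)
Require Import Defs.
From HB Require Import structures.
From mathcomp Require Import all_boot all_order all_algebra.
From mathcomp Require Import all_classical all_reals all_analysis.
From mathcomp Require Import measurable_realfun ring lra.

Set Implicit Arguments.
Unset Strict Implicit.
Unset Printing Implicit Defensive.

Import Order.TTheory GRing.Theory Num.Theory.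
Import numFieldNormedType.Exports.

Local Open Scope classical_set_scope.
Local Open Scope ring_scope.

(** The interpolated path is determined by its slopes, finitely many Gaussian
    variables, so the claim is a density statement for polynomials in variables
    with exponential moments. Two facts carry it.

    First, linear functionals of the signature are an algebra that contains
    enough functions. Products of iterated integrals are sums of iterated
    integrals ([shuffle]), and since time is a coordinate of the path, this
    algebra contains the powers of t, hence, integrating once more, all the
    integrals of q' against a coordinate for a polynomial q
    ([word_comb_pl_integral]). When q converges pointwise to the ramp that grows
    on the k-th interval of the partition only, these integrals converge to the
    k-th slope times the time spent in that interval ([word_comb_slope]). The
    slopes seen before time t are therefore measurable with respect to the
    signature functionals up to time t.

    Second, let an algebra of functions on a finite measure space have all
    moments, and call a set approximable when its indicator is a limit of the
    algebra in every L^n. The approximable sets are a sigma-algebra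
    ([sigma_algebra_approximable]). For h in the algebra with exponential
    moments, the power series of sin (h / n) converges in every L^n, and
    polynomials in sin ((h - c) / n) converge to the indicator of h < c, so
    that this set is approximable ([approximable_set_lt]). By simple functions,
    every function in L^p that is measurable for the approximable sets is a
    limit of the algebra ([approximable_Lp]).

    The path stopped at t depends continuously on t and on the slopes seen
    before t ([stopped_holder]), hence is measurable for the approximable sets
    ([measurable_fun_borel]). This yields [signature_density], for an arbitrary
    measure space that carries a time and a path. Part (i) is the case of the
    probability space with the constant time T, and part (ii) the case of its
    product with [0, T], after Fubini and a change of variables.

    Iterated integrals are handled through their local expansion: a function H
    is the integral of f against g when its increments over [s, u] are
    f x * (g u - g s) for x in [s, u], up to an error of order (u - s) ^ 2.
    Such an H is unique up to a constant, it is the Riemann-Stieltjes integral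
    ([germ_rs_integral]), and the Leibniz rule for these expansions
    ([germM]) is what makes the shuffle identity a plain induction. *)

(** * Real inequalities and limits *)

Section real_inequalities.
Context {R : realType}.
Implicit Types x y k : R.

Lemma powD_le x y n : `|x + y| ^+ n <= 2 ^+ n * (`|x| ^+ n + `|y| ^+ n).
Proof.
wlog le_xy : x y / `|x| <= `|y|.
  by move=> h; case: (leP `|x| `|y|) => [|/ltW] /h //; rewrite addrC [`|x|^+n + _]addrC.
apply: (@le_trans _ _ ((2 * `|y|) ^+ n)).
  rewrite lerXn2r ?nnegrE ?mulr_ge0// (le_trans (ler_normD _ _))//.
  by rewrite mulr2n mulrDl mul1r lerD2r.
by rewrite exprMn ler_wpM2l ?exprn_ge0// lerDr exprn_ge0.
Qed.

(** A weighted Young inequality; in integrals it replaces the Cauchy-Schwarz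
    inequality and spares the square roots. *)
Lemma powM_le x y k n : 0 < k ->
  `|x * y| ^+ n <= k * `|x| ^+ (2 * n) + k^-1 * `|y| ^+ (2 * n).
Proof.
move=> k0; rewrite normrM exprMn mulnC !exprM.
set a := `|x| ^+ n; set b := `|y| ^+ n.
have ab0 : 0 <= a * b by rewrite mulr_ge0 ?exprn_ge0.
have : 0 <= k^-1 * (k * a - b) ^+ 2 by rewrite mulr_ge0 ?sqr_ge0 ?invr_ge0 ?ltW.
have -> : k^-1 * (k * a - b) ^+ 2 = k * a ^+ 2 + k^-1 * b ^+ 2 - 2 * (a * b).
  by field; rewrite gt_eqF.
by nra.
Qed.

Lemma cvg_exprn (u : nat -> R) (l : R) n :
  u @ \oo --> l -> (fun m => u m ^+ n) @ \oo --> l ^+ n.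
Proof.
move=> ul; elim: n => [|n ih]; first exact: cvg_cst.
by under eq_fun do rewrite exprS; rewrite exprS; exact: cvgM.
Qed.

Lemma bernoulli_le x n : -1 <= x -> 1 + n%:R * x <= (1 + x) ^+ n.
Proof.
move=> x1; have [x0|x0] := leP 0 (1 + x); last by lra.
elim: n => [|n ih]; first by rewrite mul0r addr0.
rewrite exprS; apply: le_trans (ler_wpM2l x0 ih).
have : 0 <= n%:R * x ^+ 2 by rewrite mulr_ge0// sqr_ge0.
by rewrite -natr1; nra.
Qed.

Lemma cvg_nX0 x : 0 <= x < 1 -> (fun n => n%:R * x ^+ n) @ \oo --> (0 : R).
Proof.
(* For w := (1 + x) / 2 one has x <= w ^ 2, and n w ^ n is bounded. *)
move=> /andP[x0 x1]; pose w := (1 + x) / 2.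
have w0 : 0 < w by rewrite /w; lra.
have w1 : w < 1 by rewrite /w; lra.
have xw : x <= w ^+ 2 by rewrite /w; nra.
have nw n : n%:R * w ^+ n <= w / (1 - w).
  have iw1 : 1 <= w^-1 by rewrite invf_ge1 ?ltW.
  have h0 : 1 + n%:R * (w^-1 - 1) <= w^-1 ^+ n.
    have -> : w^-1 = 1 + (w^-1 - 1) by rewrite addrCA subrr addr0.
    rewrite [X in n%:R * X](_ : _ = w^-1 - 1) ?bernoulli_le//; lra.
  have h : (1 + n%:R * (w^-1 - 1)) * w ^+ n <= 1.
    by rewrite -ler_pdivlMr ?exprn_gt0// mul1r -exprVn.
  have -> : n%:R * w ^+ n = (w / (1 - w)) * ((n%:R * (w^-1 - 1)) * w ^+ n).
    by field; rewrite (gt_eqF w0) subr_eq0 eq_sym (lt_eqF w1).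
  apply: ler_piMr; first by rewrite divr_ge0 ?subr_ge0 ?ltW.
  apply: le_trans h.
  by rewrite ler_wpM2r ?exprn_ge0 ?lerDr ?ltW.
apply: (@squeeze_cvgr _ _ _ _ (cst 0) (fun n => (w / (1 - w)) * w ^+ n)).
- apply: nearW => n; rewrite mulr_ge0 ?exprn_ge0//=.
  apply: (@le_trans _ _ (n%:R * (w ^+ 2) ^+ n)).
    by rewrite ler_wpM2l// lerXn2r ?nnegrE// sqr_ge0.
  by rewrite -exprM mulnC exprM expr2 mulrA; apply: ler_wpM2r; rewrite ?nw ?exprn_ge0 ?ltW.
- exact: cvg_cst.
- rewrite -[X in _ --> X](mulr0 (w / (1 - w))); apply: cvgM; [exact: cvg_cst|].
  by apply: cvg_expr; rewrite ger0_norm ?ltW.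
Qed.

(** Bernoulli's inequality bounds the left side below by 1 - n (2 x) ^ n, which
    tends to 1 for x < 1/2, and above by 2 ^ -n for x >= 1/2. The factor n in
    the exponent serves the case x = 1/2. *)
Lemma cvg_threshold x : 0 <= x <= 1 ->
  (fun n => (1 - x ^+ n) ^+ (2 ^ n * n)%N) @ \oo --> ((x < 2^-1)%R%:R : R).
Proof.
move=> /andP[x0 x1]; have xn n : 0 <= x ^+ n <= 1 by rewrite exprn_ge0//= exprn_ile1.
have [xh|xh] := ltP x 2^-1.
  apply: (@squeeze_cvgr _ _ _ _ (fun n => 1 - n%:R * (2 * x) ^+ n) (cst 1)).
  - apply: nearW => n; apply/andP; split; last first.
      by rewrite exprn_ile1 ?subr_ge0 ?gerBl//; have /andP[] := xn n.
    have := @bernoulli_le (- x ^+ n) (2 ^ n * n); rewrite lerN2 (andP (xn n)).2.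
    move=> /(_ isT); apply: le_trans; rewrite mulrN lerD2l lerN2 natrM natrX exprMn.
    by rewrite mulrAC [leRHS]mulrC.
  - rewrite -[X in _ --> X]subr0; apply: cvgB; first exact: cvg_cst.
    by apply: cvg_nX0; apply/andP; split; lra.
  - exact: cvg_cst.
apply: (@squeeze_cvgr _ _ _ _ (cst 0) (fun n => (2^-1) ^+ n)).
- apply: nearW => n; have /andP[a b] := xn n; rewrite exprn_ge0 ?subr_ge0//=.
  rewrite exprM lerXn2r ?nnegrE ?exprn_ge0 ?subr_ge0//.
  set u := x ^+ n in a b *; set N := (2 ^ n)%N.
  have Nu : 1 <= N%:R * u.
    by rewrite /N /u natrX -exprMn exprn_ege1//; lra.
  have h1 : 1 + N%:R * u <= (1 + u) ^+ N by apply: bernoulli_le; lra.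
  have h2 : (1 - u) ^+ N * (1 + u) ^+ N <= 1.
    by rewrite -exprMn exprn_ile1//; nra.
  have h3 : 0 <= (1 - u) ^+ N by rewrite exprn_ge0// subr_ge0.
  have h4 : (1 - u) ^+ N * 2 <= (1 - u) ^+ N * (1 + u) ^+ N.
    by rewrite ler_wpM2l//; apply: le_trans h1; lra.
  by lra.
- exact: cvg_cst.
- by apply: cvg_expr; rewrite ger0_norm//; lra.
Qed.

(** Lets norms of integer order control norms of real order: eta makes the first
    term small, and then approximation in L^n makes the second one small. *)
Lemma powR_split (p : R) n (eta y : R) : 0 < eta -> 0 <= y -> 0 <= p <= n%:R ->
  y `^ p <= eta `^ p + (eta `^ p * (eta ^- n)) * y ^+ n.
Proof.
move=> eta0 y0 /andP[p0 pn]; have [yeta|etay] := leP y eta.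
  apply: le_trans (_ : _ <= eta `^ p) _; first by apply: ge0_ler_powR => //; rewrite nnegrE ltW.
  by rewrite lerDl !mulr_ge0 ?powR_ge0 ?invr_ge0 ?exprn_ge0 ?(ltW eta0).
apply: le_trans (_ : _ <= eta `^ p * (eta ^- n) * y ^+ n) _; last first.
  by rewrite lerDr powR_ge0.
have ye : y = eta * (y / eta) by rewrite mulrC divfK ?gt_eqF.
have ye1 : 1 <= y / eta by rewrite ler_pdivlMr// mul1r ltW.
rewrite {1}ye powRM ?divr_ge0 ?(ltW eta0)// -mulrA ler_wpM2l ?powR_ge0//.
rewrite -exprVn -exprMn [eta^-1 * y]mulrC -powR_mulrn ?divr_ge0 ?(ltW eta0)//.
exact: ler_powR.
Qed.

Lemma powRD_le (p x y : R) : 0 <= p ->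
  `|x + y| `^ p <= 2 `^ p * (`|x| `^ p + `|y| `^ p).
Proof.
move=> p0; wlog le_xy : x y / `|x| <= `|y|.
  by move=> h; case: (leP `|x| `|y|) => [|/ltW] /h //; rewrite addrC [`|x| `^ p + _]addrC.
apply: (@le_trans _ _ ((2 * `|y|) `^ p)).
  rewrite ge0_ler_powR ?nnegrE ?mulr_ge0// (le_trans (ler_normD _ _))//.
  by rewrite mulr2n mulrDl mul1r lerD2r.
by rewrite powRM// ler_wpM2l ?powR_ge0// lerDr powR_ge0.
Qed.

Lemma cvg_powR0 (u : nat -> R) (p : R) : 1 <= p -> (forall n, 0 <= u n) ->
  u @ \oo --> (0 : R) -> (fun n => u n `^ p) @ \oo --> (0 : R).
Proof.
move=> p1 u0 cvu; have up : \forall n \near \oo, 0 <= u n `^ p <= u n.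
  have : \forall n \near \oo, u n < 1.
    by apply: (cvgr_lt (0 : R)) => //; exact: ltr01.
  apply: filterS => n un1; rewrite powR_ge0/=.
  have [->|un0] := eqVneq (u n) 0; first by rewrite powR0// gt_eqF// (lt_le_trans _ p1).
  by apply: ge1r_powR => //; rewrite lt_neqAle eq_sym un0 u0/= ltW.
by apply: (squeeze_cvgr up) => //; exact: cvg_cst.
Qed.

(** Uniform in n, so that exponential moments allow dominated convergence. *)
Lemma sin_series_le x n : `|series (sin_coeff x) n| <= expR `|x|.
Proof.
apply: (@le_trans _ _ (series (exp_coeff `|x|) n)).
  rewrite /series/=; apply: le_trans (ler_norm_sum _ _ _) _.
  apply: ler_sum => k _; rewrite /exp_coeff /sin_coeff /=.
  rewrite !normrM normfV !normr_nat !normrX normrN normr1 expr1n mulr1.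
  by case: odd; [rewrite mul1r| rewrite !mul0r].
apply: nondecreasing_cvgn_le; last exact: is_cvg_series_exp_coeff.
by apply: nondecreasing_series => k _ _; exact: exp_coeff_ge0.
Qed.

Lemma sin_lt0 x : -1 <= x <= 1 -> (sin x < 0) = (x < 0).
Proof.
have p2 := pi_ge2 R => /andP[a b]; have [x0|x0|->] := ltgtP x 0.
- by rewrite -oppr_gt0 -sinN sin_gt0_pi//; apply/andP; split; lra.
- apply/negbTE; rewrite -leNgt ltW// sin_gt0_pi//; apply/andP; split; lra.
- by rewrite sin0 ltxx.
Qed.

End real_inequalities.

(** * Approximation in every L^n by an algebra of functions *)

Section integrals.
Context d (E : measurableType d) (R : realType).
Variable mu : {measure set E -> \bar R}.
Implicit Types h g : E -> R.

Lemma int_le h g : measurable_fun setT h -> measurable_fun setT g ->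
  (forall x, 0 <= h x) -> (forall x, h x <= g x) ->
  (\int[mu]_x (h x)%:E <= \int[mu]_x (g x)%:E)%E.
Proof.
move=> mh mg h0 hg; apply: ge0_le_integral => //.
- by move=> x _; rewrite lee_fin.
- exact/measurable_EFinP.
- exact/measurable_EFinP.
- by move=> x _; rewrite lee_fin.
Qed.

Lemma int_lin h g (a b : R) : measurable_fun setT h -> measurable_fun setT g ->
  (forall x, 0 <= h x) -> (forall x, 0 <= g x) -> 0 <= a -> 0 <= b ->
  (\int[mu]_x (a * h x + b * g x)%:E =
   a%:E * \int[mu]_x (h x)%:E + b%:E * \int[mu]_x (g x)%:E)%E.
Proof.
move=> mh mg h0 g0 a0 b0.
under eq_integral do rewrite EFinD !EFinM.
rewrite ge0_integralD//=.
- rewrite !ge0_integralZl//.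
  + exact/measurable_EFinP.
  + by move=> x _; rewrite lee_fin.
  + exact/measurable_EFinP.
  + by move=> x _; rewrite lee_fin.
- by move=> x _; rewrite -EFinM lee_fin mulr_ge0.
- by apply/measurable_EFinP; exact: measurable_funM.
- by move=> x _; rewrite -EFinM lee_fin mulr_ge0.
- by apply/measurable_EFinP; exact: measurable_funM.
Qed.

Lemma int_ge0 h : (forall x, 0 <= h x) -> (0 <= \int[mu]_x (h x)%:E)%E.
Proof. by move=> h0; apply: integral_ge0 => x _; rewrite lee_fin. Qed.

Lemma int_dominated (h_ : nat -> E -> R) h g :
  (forall n, measurable_fun setT (h_ n)) -> measurable_fun setT g ->
  (forall x, h_ ^~ x @ \oo --> h x) ->
  (forall n x, `|h_ n x| <= g x) -> (\int[mu]_x (g x)%:E < +oo)%E ->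
  (\int[mu]_x (h_ n x)%:E)%E @[n --> \oo] --> (\int[mu]_x (h x)%:E)%E.
Proof.
move=> mh mg cvh hg ig.
have g0 x : 0 <= g x by apply: le_trans (hg 0%N x).
have mh' : measurable_fun setT h.
  by apply: measurable_fun_cvg mh _ => x _; exact: cvh.
have ig' : mu.-integrable setT (EFin \o g).
  apply/integrableP; split; first exact/measurable_EFinP.
  by under eq_integral do rewrite /= ger0_norm//.
have [] := @dominated_convergence _ _ _ mu setT measurableT
  (fun n => EFin \o h_ n) (EFin \o h) (EFin \o g) _ _ _ ig' _.
- by move=> n; exact/measurable_EFinP.
- exact/measurable_EFinP.
- by apply: aeW => x _; apply/cvg_EFin; [exact: nearW|exact: cvh].
- by apply: aeW => x n _; rewrite /= lee_fin.
- by [].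
Qed.

Lemma int_dominated0 (h_ : nat -> E -> R) g :
  (forall n, measurable_fun setT (h_ n)) -> measurable_fun setT g ->
  (forall x, h_ ^~ x @ \oo --> 0) ->
  (forall n x, 0 <= h_ n x <= g x) -> (\int[mu]_x (g x)%:E < +oo)%E ->
  forall e : R, 0 < e -> exists n, (\int[mu]_x (h_ n x)%:E < e%:E)%E.
Proof.
move=> mh mg cvh hg ig e e0.
have hg' n x : `|h_ n x| <= g x by have /andP[? ?] := hg n x; rewrite ger0_norm.
have := @int_dominated h_ (cst 0) g mh mg cvh hg' ig; rewrite integral0.
move=> /(_ [set y | (y < e%:E)%E]) h.
have [|N _ /(_ N (leqnn _)) /= ?] := h _; last by exists N.
exact: (@open_ereal_lt' _ 0%E e%:E).
Qed.

End integrals.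

Section closure.
Context d (E : measurableType d) (R : realType).
Variable mu : {measure set E -> \bar R}.
Implicit Types h g a b : E -> R.

Definition has_moments h := measurable_fun setT h /\
  forall n, (\int[mu]_x (`|h x| ^+ n)%:E < +oo)%E.

Lemma measurable_absX h n : measurable_fun setT h ->
  measurable_fun setT (fun x => `|h x| ^+ n).
Proof. by move=> mh; apply: measurable_funX; exact: measurableT_comp. Qed.

Lemma absX_ge0 h n x : 0 <= `|h x| ^+ n. Proof. exact: exprn_ge0. Qed.

Hint Resolve absX_ge0 : core.

Lemma has_momentsD h g : has_moments h -> has_moments g ->
  has_moments (fun x => h x + g x).
Proof.
move=> [mh ih] [mg ig]; split; first exact: measurable_funD.
move=> n; apply: (@le_lt_trans _ _
  (\int[mu]_x (2 ^+ n * `|h x| ^+ n + 2 ^+ n * `|g x| ^+ n)%:E)%E).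
  apply: int_le => [||//|x].
  - exact/(@measurable_absX (fun x => h x + g x))/measurable_funD.
  - by apply: measurable_funD; apply: measurable_funM => //; exact: measurable_absX.
  - by rewrite -mulrDr powD_le.
rewrite int_lin ?exprn_ge0//; try exact: measurable_absX.
by apply: lte_add_pinfty; apply: lte_mul_pinfty; rewrite ?lee_fin ?exprn_ge0.
Qed.

Lemma has_momentsM h g : has_moments h -> has_moments g ->
  has_moments (fun x => h x * g x).
Proof.
move=> [mh ih] [mg ig]; split; first exact: measurable_funM.
move=> n; apply: (@le_lt_trans _ _
  (\int[mu]_x (1 * `|h x| ^+ (2 * n) + 1 * `|g x| ^+ (2 * n))%:E)%E).
  apply: int_le => [||//|x].
  - exact/(@measurable_absX (fun x => h x * g x))/measurable_funM.
  - by apply: measurable_funD; apply: measurable_funM => //; exact: measurable_absX.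
  - by apply: le_trans (@powM_le _ _ _ 1 _ _) _; rewrite ?invr1.
rewrite int_lin ?exprn_ge0//; try exact: measurable_absX.
by rewrite !mul1e lte_add_pinfty.
Qed.

Lemma has_moments_le h g : measurable_fun setT h -> has_moments g ->
  (forall x, `|h x| <= g x) -> has_moments h.
Proof.
move=> mh [mg ig] hg; split => // n; apply: le_lt_trans (ig n).
apply: int_le => [||//|x]; try exact: measurable_absX.
by rewrite lerXn2r ?nnegrE// (le_trans (hg x))// ler_norm.
Qed.

(** Multiplication by h is continuous from L^(2n) to L^n at 0. *)
Lemma small_mul h n (e : R) : has_moments h -> 0 < e -> exists2 k : R, 0 < k &
  forall g, measurable_fun setT g ->
    (\int[mu]_x (`|g x| ^+ (2 * n))%:E < k%:E)%E ->
    (\int[mu]_x (`|h x * g x| ^+ n)%:E < e%:E)%E.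
Proof.
move=> [mh ih] e0; set I := (\int[mu]_x (`|h x| ^+ (2 * n))%:E)%E.
have I0 : (0 <= I)%E by exact: int_ge0.
have finI : I \is a fin_num by rewrite ge0_fin_numE// ih.
pose k := e / 2 / (fine I + 1).
have I1 : 0 < fine I + 1 by rewrite ltr_wpDl// fine_ge0.
have k0 : 0 < k by rewrite /k !divr_gt0.
exists (k * (e / 2)); first by rewrite mulr_gt0// divr_gt0.
move=> g mg ig; apply: (@le_lt_trans _ _
  (\int[mu]_x (k * `|h x| ^+ (2 * n) + k^-1 * `|g x| ^+ (2 * n))%:E)%E).
  apply: int_le => [||//|x].
  - exact/(@measurable_absX (fun x => h x * g x))/measurable_funM.
  - by apply: measurable_funD; apply: measurable_funM => //; exact: measurable_absX.
  - exact: powM_le.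
rewrite int_lin ?invr_ge0 ?(ltW k0)//; try exact: measurable_absX.
rewrite -/I -(fineK finI) -EFinM.
set J := (\int[mu]_x _)%E in ig *.
have J0 : (0 <= J)%E by exact: int_ge0.
have finJ : J \is a fin_num by rewrite ge0_fin_numE// (lt_trans ig)// ltry.
move: ig; rewrite -(fineK finJ) -EFinM -EFinD !lte_fin => ig.
have -> : e = e / 2 + e / 2 by rewrite -splitr.
apply: ler_ltD.
  by rewrite /k mulrAC ler_pdivrMr// ler_pM2l ?divr_gt0// lerDl.
by rewrite mulrC ltr_pdivrMr// mulrC.
Qed.

Variable alg : set (E -> R).
Hypothesis alg_moments : forall h, alg h -> has_moments h.
Hypothesis alg_cst : forall c, alg (cst c).
Hypothesis algD : forall h g, alg h -> alg g -> alg (fun x => h x + g x).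
Hypothesis algM : forall h g, alg h -> alg g -> alg (fun x => h x * g x).

(** Approximation in every L^n at once, not in one L^p, is what is stable under
    products. *)
Definition approximable h := has_moments h /\
  forall n (e : R), 0 < e -> exists2 a, alg a &
    (\int[mu]_x (`|h x - a x| ^+ n.+1)%:E < e%:E)%E.

Lemma approximable_alg h : alg h -> approximable h.
Proof.
move=> ah; split; first exact: alg_moments.
move=> n e e0; exists h => //; under eq_integral do rewrite subrr normr0 expr0n/=.
by rewrite integral0.
Qed.

Let mB h a : measurable_fun setT h -> alg a ->
  measurable_fun setT (fun x => h x - a x).
Proof. by move=> mh /alg_moments[ma _]; exact: measurable_funB. Qed.

Lemma small_add n (e : R) : 0 < e -> exists2 k : R, 0 < k &
  forall h g, measurable_fun setT h -> measurable_fun setT g ->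
    (\int[mu]_x (`|h x| ^+ n)%:E < k%:E)%E ->
    (\int[mu]_x (`|g x| ^+ n)%:E < k%:E)%E ->
    (\int[mu]_x (`|h x + g x| ^+ n)%:E < e%:E)%E.
Proof.
move=> e0; pose k := e / 2 / 2 ^+ n; exists k; first by rewrite !divr_gt0// exprn_gt0.
move=> h g mh mg ih ig; apply: (@le_lt_trans _ _
  (\int[mu]_x (2 ^+ n * `|h x| ^+ n + 2 ^+ n * `|g x| ^+ n)%:E)%E).
  apply: int_le => [||//|x].
  - exact/(@measurable_absX (fun x => h x + g x))/measurable_funD.
  - by apply: measurable_funD; apply: measurable_funM => //; exact: measurable_absX.
  - by rewrite -mulrDr powD_le.
rewrite int_lin ?exprn_ge0//; try exact: measurable_absX.
have -> : (e%:E = (2 ^+ n)%:E * k%:E + (2 ^+ n)%:E * k%:E)%E.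
  rewrite -!EFinM -EFinD /k; congr EFin; rewrite mulrC divfK ?expf_neq0//.
  by rewrite -splitr.
by apply: lteD; rewrite lte_pmul2l// lte_fin exprn_gt0.
Qed.

Lemma approximableD h g : approximable h -> approximable g ->
  approximable (fun x => h x + g x).
Proof.
move=> [mh ah] [mg ag]; split; first exact: has_momentsD.
move=> n e /(small_add n.+1)[k k0 hk].
have [a aa ia] := ah n _ k0; have [b ab ib] := ag n _ k0.
exists (fun x => a x + b x); first exact: algD.
under eq_integral do rewrite opprD addrACA.
by apply: hk => //; apply: mB => //; [case: mh|case: mg].
Qed.

Lemma approximableM h g : approximable h -> approximable g ->
  approximable (fun x => h x * g x).
Proof.
move=> [mh ah] [mg ag]; split; first exact: has_momentsM.
move=> n e /(small_add n.+1)[k k0 hk].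
have [l l0 hl] := small_mul n.+1 mh k0.
(* The approximation of g comes first: that of h depends on its moments. *)
have [b' ab' ib'] := ag (2 * n.+1).-1 _ l0.
have [m' m'0 hm'] := small_mul n.+1 (alg_moments ab') k0.
have [a' aa' ia'] := ah (2 * n.+1).-1 _ m'0.
exists (fun x => a' x * b' x); first exact: algM.
have hE x : h x * g x - a' x * b' x = h x * (g x - b' x) + b' x * (h x - a' x).
  by ring.
under eq_integral do rewrite hE.
apply: hk.
- by apply: measurable_funM; [case: mh|apply: mB => //; case: mg].
- by apply: measurable_funM; [case: (alg_moments ab')|apply: mB => //; case: mh].
- by apply: hl => //; apply: mB => //; case: mg.
- by apply: hm' => //; apply: mB => //; case: mh.
Qed.

Lemma approximable_cst c : approximable (cst c).
Proof. exact: approximable_alg. Qed.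

Lemma approximableX h n : approximable h -> approximable (fun x => h x ^+ n).
Proof.
move=> ah; elim: n => [|n ih]; first exact: (approximable_cst 1).
by under eq_fun do rewrite exprS; exact: approximableM.
Qed.

Lemma approximable_lim (h_ : nat -> E -> R) h g :
  (forall n, approximable (h_ n)) -> has_moments g ->
  (forall x, h_ ^~ x @ \oo --> h x) -> (forall n x, `|h_ n x| <= g x) ->
  approximable h.
Proof.
move=> ah mg cvh hg.
have mh_ n : measurable_fun setT (h_ n) by case: (ah n) => -[].
have mh : measurable_fun setT h.
  by apply: measurable_fun_cvg mh_ _ => x _; exact: cvh.
have hg' x : `|h x| <= g x.
  rewrite -[leRHS](@lim_cst _ _ nat \oo)//.
  have -> : `|h x| = limn (fun n => `|h_ n x|).
    by apply/esym/cvg_lim => //; apply: cvg_norm; exact: cvh.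
  apply: ler_lim; [|exact: is_cvg_cst|exact: nearW].
  by apply/cvg_ex; exists `|h x|; apply: cvg_norm; exact: cvh.
split; first exact: has_moments_le mg hg'.
move=> n e /(small_add n.+1)[k k0 hk].
have [|||||N iN] := @int_dominated0 _ _ _ mu
   (fun m x => `|h x - h_ m x| ^+ n.+1)
   (fun x => (2 * g x) ^+ n.+1) _ _ _ _ _ k k0.
- by move=> m; exact/(@measurable_absX (fun x => h x - h_ m x))/measurable_funB.
- by apply: measurable_funX; apply: measurable_funM => //; case: mg.
- move=> x; rewrite [X in _ --> X](_ : _ = `|h x - h x| ^+ n.+1); last first.
    by rewrite subrr normr0 expr0n.
  apply: cvg_exprn.
  by apply: cvg_norm; apply: cvgB; [exact: cvg_cst|exact: cvh].
- move=> m x; rewrite exprn_ge0//= lerXn2r ?nnegrE//.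
    by rewrite mulr_ge0// (le_trans _ (hg' x)).
  by rewrite (le_trans (ler_normB _ _))// mulr2n mulrDl mul1r lerD.
- have [m2 i2] := has_momentsD mg mg.
  apply: le_lt_trans (i2 n.+1); apply: int_le.
  + by apply: measurable_funX; apply: measurable_funM => //; case: mg.
  + exact: measurable_absX.
  + by move=> x; rewrite exprn_ge0// mulr_ge0// (le_trans _ (hg' x)).
  + move=> x; rewrite lerXn2r ?nnegrE//.
      by rewrite mulr_ge0// (le_trans _ (hg' x)).
    by rewrite mulr2n mulrDl mul1r ler_norm.
have [a aa ia] := (ah N).2 n _ k0.
exists a => //.
have hE x : h x - a x = (h x - h_ N x) + (h_ N x - a x) by ring.
under eq_integral do rewrite hE.
by apply: hk => //; [exact: measurable_funB|exact: mB].
Qed.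

Lemma approximable_bounded_lim (h_ : nat -> E -> R) h (c : R) :
  (forall n, approximable (h_ n)) ->
  (forall x, h_ ^~ x @ \oo --> h x) -> (forall n x, `|h_ n x| <= c) ->
  approximable h.
Proof.
by move=> ah; apply: approximable_lim ah (alg_moments (alg_cst c)).
Qed.

Definition approximable_set S := measurable S /\ approximable (\1_S).

Lemma approximable_set_threshold b : approximable b ->
  (forall x, 0 <= b x <= 1) -> approximable (fun x => (b x < 2^-1)%R%:R).
Proof.
move=> ab b01.
apply: (@approximable_bounded_lim (fun n x => (1 - b x ^+ n) ^+ (2 ^ n * n)) _ 1).
- move=> n; apply: approximableX; apply: approximableD; first exact: approximable_cst.
  under eq_fun do rewrite -mulN1r.
  by apply: approximableM; [exact: approximable_cst|exact: approximableX].
- by move=> x; exact: cvg_threshold.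
- move=> n x; have /andP[b0 b1] := b01 x.
  have h0 : 0 <= 1 - b x ^+ n by rewrite subr_ge0 exprn_ile1.
  by rewrite ger0_norm ?exprn_ge0// exprn_ile1// gerBl exprn_ge0.
Qed.

Definition has_exp_moments h := measurable_fun setT h /\
  forall c : R, (\int[mu]_x (expR (c * `|h x|))%:E < +oo)%E.

Lemma measurable_exp_abs c h : measurable_fun setT h ->
  measurable_fun setT (fun x => expR (c * `|h x|)).
Proof.
move=> mh; apply: measurableT_comp; first exact: measurable_expR.
by apply: measurable_funM => //; exact: measurableT_comp.
Qed.

Lemma exp_has_moments h c : has_exp_moments h ->
  has_moments (fun x => expR (c * `|h x|)).
Proof.
move=> [mh ih]; split; first exact: measurable_exp_abs.
move=> n; under eq_integral do rewrite ger0_norm ?expR_ge0// -expRM_natl mulrA.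
exact: ih.
Qed.

Lemma has_exp_momentsB h c : has_exp_moments h -> has_exp_moments (fun x => h x + c).
Proof.
move=> [mh ih]; split; first exact: measurable_funD.
move=> k; apply: (@le_lt_trans _ _
  (\int[mu]_x (expR (`|k| * `|c|) * expR (`|k| * `|h x|) + 0 * 0)%:E)%E).
  apply: int_le => [||x|x].
  - exact/(@measurable_exp_abs _ (fun x => h x + c))/measurable_funD.
  - apply: measurable_funD => //; apply: measurable_funM => //.
    exact: measurable_exp_abs.
  - exact: expR_ge0.
  - rewrite mul0r addr0 -expRD ler_expR -mulrDr.
    apply: le_trans (ler_wpM2r _ (ler_norm k)) _ => //.
    by rewrite ler_wpM2l// addrC ler_normD.
rewrite int_lin ?expR_ge0//; try exact: measurable_exp_abs.
by rewrite mul0e adde0; apply: lte_mul_pinfty => //; rewrite lee_fin expR_ge0.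
Qed.

Lemma alg_sum (F : nat -> E -> R) n : (forall k, alg (F k)) ->
  alg (fun x => \sum_(0 <= k < n) F k x).
Proof.
move=> aF; elim: n => [|n ih].
  by under eq_fun do rewrite big_nil; exact: alg_cst.
by under eq_fun do rewrite big_nat_recr//=; exact: algD.
Qed.

Lemma algX h n : alg h -> alg (fun x => h x ^+ n).
Proof.
move=> ah; elim: n => [|n ih]; first exact: (alg_cst 1).
by under eq_fun do rewrite exprS; exact: algM.
Qed.

(** The partial sums of the power series are dominated by expR (|c| * |h|): this
    is where exponential moments are used. *)
Lemma approximable_sin h c : alg h -> has_exp_moments h ->
  approximable (fun x => sin (c * h x)).
Proof.
move=> ah eh.
apply: (@approximable_lim (fun n x => series (sin_coeff (c * h x)) n) _
  (fun x => expR (`|c| * `|h x|))).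
- move=> n; apply: approximable_alg; rewrite /series/=; apply: alg_sum => k.
  under eq_fun do rewrite sin_coeffE; apply: algM; first exact: alg_cst.
  by apply: algX; apply: algM => //; exact: alg_cst.
- exact: exp_has_moments.
- by move=> x; rewrite unlock; exact: is_cvg_series_sin_coeff.
- by move=> n x; rewrite -normrM; exact: sin_series_le.
Qed.

(** The function (1 + sin ((h - c) / n)) / 2 takes its values in [0, 1], and it
    is below 1/2 exactly where h < c as soon as |h - c| <= n. *)
Lemma approximable_set_lt h c : alg h -> has_exp_moments h ->
  approximable_set [set x | h x < c].
Proof.
move=> ah eh; have [mh _] := eh; split.
  by rewrite -[X in measurable X]setTI -preimage_itvNyo; exact: mh.
pose g x := h x - c.
have ag : alg g by apply: algD => //; exact: alg_cst.
have eg : has_exp_moments g by exact: has_exp_momentsB.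
apply: (@approximable_bounded_lim
  (fun n x => ((1 + sin (n.+1%:R^-1 * g x)) / 2 < 2^-1)%R%:R) _ 1).
- move=> n; apply: approximable_set_threshold.
    apply: approximableM; last exact: approximable_cst.
    by apply: approximableD; [exact: approximable_cst|exact: approximable_sin].
  move=> x; have := sin_geN1 (n.+1%:R^-1 * g x); have := sin_le1 (n.+1%:R^-1 * g x).
  by lra.
- move=> x; apply: cvg_near_cst; exists (Num.bound `|g x|) => // n /= gn.
  set y := n.+1%:R^-1 * g x.
  have gn' : `|g x| <= n.+1%:R.
    rewrite ltW// (lt_le_trans (archi_boundP _))// ler_nat.
    by rewrite ltnW.
  have : -1 <= y <= 1.
    by rewrite -ler_norml /y normrM normfV normr_nat mulrC ler_pdivrMr// mul1r.
  move=> /sin_lt0 e.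
  have -> : ((1 + sin y) / 2 < 2^-1) = (sin y < 0) by apply/idP/idP; lra.
  rewrite e /y pmulr_rlt0 ?invr_gt0// /g subr_lt0 indicE.
  have [hc|hc] := ltP (h x) c; first by rewrite mem_set.
  by rewrite memNset//=; apply/negP; rewrite -leNgt.
- by move=> n x; case: (_ < _); rewrite ?normr0 ?normr1.
Qed.

Lemma approximable_setC S : approximable_set S -> approximable_set (~` S).
Proof.
move=> [mS aS]; split; first exact: measurableC.
rewrite (_ : \1__ = fun x => 1 + (-1) * \1_S x); last first.
  by apply/funext => x; rewrite indicC indicE; case: (x \in S); rewrite /= mulN1r ?subrr ?subr0.
apply: approximableD; first exact: approximable_cst.
by apply: approximableM => //; exact: approximable_cst.
Qed.

Lemma approximable_setI S S' : approximable_set S -> approximable_set S' ->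
  approximable_set (S `&` S').
Proof.
move=> [mS aS] [mS' aS']; split; first exact: measurableI.
by rewrite indicI; exact: approximableM.
Qed.

Lemma approximable_set0 : approximable_set set0.
Proof.
split => //; rewrite (_ : \1__ = cst 0); first exact: approximable_cst.
by apply/funext => x; rewrite indic0.
Qed.

(** Indicators multiply under intersections, and those of finite unions converge
    boundedly to that of the union. *)
Lemma sigma_algebra_approximable : sigma_algebra setT approximable_set.
Proof.
split; first exact: approximable_set0.
  by move=> S aS; rewrite setTD; exact: approximable_setC.
move=> F aF; split; first by apply: bigcup_measurable => k _; case: (aF k).
pose G n := \big[setU/set0]_(k < n) F k.
have aG n : approximable_set (G n).
  rewrite /G; elim: n => [|n ih]; first by rewrite big_ord0; exact: approximable_set0.
  rewrite big_ord_recr/= -[X in X `|` _]setCK -[X in _ `|` X]setCK -setCI.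
  by apply: approximable_setC; apply: approximable_setI; exact: approximable_setC.
apply: (@approximable_bounded_lim (fun n => \1_(G n)) _ 1).
- by move=> n; case: (aG n).
- move=> x; have [[k _ Fkx]|nF] := pselect ((\bigcup_k F k) x).
    apply: cvg_near_cst; exists k.+1 => // n /= kn; rewrite !indicE !mem_set//.
      by exists k.
    by rewrite /G -bigcup_mkord; exists k.
  apply: cvg_near_cst; apply: nearW => n; rewrite !indicE !memNset//.
  by rewrite /G -bigcup_mkord => -[k _ Fkx]; apply: nF; exists k.
- by move=> n x; rewrite indicE; case: (_ \in _); rewrite ?normr0 ?normr1.
Qed.

Let appT := g_sigma_algebraType approximable_set.

Lemma measurable_approximable (S : set E) :
  (measurable (S : set appT)) = approximable_set S.
Proof.
have := measurable_g_measurableTypeE sigma_algebra_approximable.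
by rewrite /measurable/= => ->.
Qed.

Import HBNNSimple.

Lemma approximable_sum (I : eqType) (s : seq I) (F : I -> E -> R) :
  (forall i, i \in s -> approximable (F i)) ->
  approximable (fun x => \sum_(i <- s) F i x).
Proof.
elim: s => [|i s ih] aF.
  by under eq_fun do rewrite big_nil; exact: approximable_cst.
under eq_fun do rewrite big_cons; apply: approximableD.
  by apply: aF; rewrite mem_head.
by apply: ih => j js; apply: aF; rewrite in_cons js orbT.
Qed.

Lemma approximable_nnsfun (g : {nnsfun appT >-> R}) : approximable (g : E -> R).
Proof.
have /finite_seqP[s gs] : finite_set (range g) by exact: fimfunP.
rewrite (_ : (g : E -> R) = fun x => \sum_(y <- undup s) y * \1_(g @^-1` [set y]) x);
    last first.
  apply/funext => x; have gxs : g x \in undup s.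
    by rewrite mem_undup; have : range g (g x) by []; rewrite gs.
  rewrite (bigD1_seq (g x)) ?undup_uniq//= big1 => [|y ygx].
    by rewrite indicE mem_set// mulr1 addr0.
  by rewrite indicE memNset ?mulr0//= => gxy; rewrite gxy eqxx in ygx.
apply: approximable_sum => y _; apply: approximableM; first exact: approximable_cst.
have : measurable (g @^-1` [set y] : set appT) by [].
by rewrite measurable_approximable => -[].
Qed.

(** Simple functions over approximable sets are dense, and they are approximable
    in L^n for some n >= p, hence in L^p because the measure is finite. *)
Theorem approximable_Lp (p : R) (f : E -> R) : 1 <= p ->
  measurable_fun setT (f : appT -> R) ->
  (\int[mu]_x (`|f x| `^ p)%:E < +oo)%E ->
  forall e : R, 0 < e -> exists2 a, alg a &
    (\int[mu]_x (`|f x - a x| `^ p)%:E < e%:E)%E.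
Proof.
move=> p1 mf fp e e0; have p0 : 0 <= p by exact: le_trans p1.
have mfE : measurable_fun setT f.
  move=> _ Y mY; have := mf measurableT Y mY.
  by rewrite measurable_approximable => -[].
have mfp : measurable_fun setT (EFin \o f^\+ : appT -> \bar R).
  by apply/measurable_EFinP; exact: measurable_funrpos.
have mfn : measurable_fun setT (EFin \o f^\- : appT -> \bar R).
  by apply/measurable_EFinP; exact: measurable_funrneg.
have fp0 x : setT x -> (0 <= (EFin \o (f^\+)%R) x)%E by rewrite lee_fin funrpos_ge0.
have fn0 x : setT x -> (0 <= (EFin \o (f^\-)%R) x)%E by rewrite lee_fin funrneg_ge0.
pose u n : E -> R := nnsfun_approx measurableT mfp n.
pose v n : E -> R := nnsfun_approx measurableT mfn n.
pose h n x := u n x - v n x.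
have ah n : approximable (h n).
  apply: approximableD; first exact: approximable_nnsfun.
  under eq_fun do rewrite -mulN1r.
  by apply: approximableM; [exact: approximable_cst|exact: approximable_nnsfun].
have mh n : measurable_fun setT (h n) by case: (ah n) => -[].
have hf n x : `|f x - h n x| <= `|f x|.
  have u0 : 0 <= u n x by exact: fun_ge0.
  have v0 : 0 <= v n x by exact: fun_ge0.
  have : u n x <= f^\+ x by rewrite -lee_fin /u nnsfun_approxE; exact: le_approx.
  have : v n x <= f^\- x by rewrite -lee_fin /v nnsfun_approxE; exact: le_approx.
  rewrite /h /funrpos /funrneg; have [f0|f0] := leP 0 (f x).
    rewrite (max_idPr _) ?oppr_le0// (ger0_norm f0) => *.
    by rewrite ler_norml; apply/andP; split; lra.
  have -> : Num.max (- f x) 0 = - f x by apply/max_idPl; rewrite oppr_ge0 ltW.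
  rewrite (ltr0_norm f0) => *.
  by rewrite ler_norml; apply/andP; split; lra.
have cvh x : h ^~ x @ \oo --> f x.
  rewrite [X in _ --> X](_ : _ = f^\+ x - f^\- x); last first.
    by rewrite -[in LHS](funrposBneg f).
  apply: cvgB.
    by have /fine_cvgP[_] := cvg_nnsfun_approx measurableT mfp fp0 (Logic.I : setT x).
  by have /fine_cvgP[_] := cvg_nnsfun_approx measurableT mfn fn0 (Logic.I : setT x).
have mpow (g : E -> R) : measurable_fun setT g -> measurable_fun setT (fun x => `|g x| `^ p).
  move=> mg; apply: (measurableT_comp (measurable_powR p)).
  exact: measurableT_comp.
pose k := e / 2 / 2 `^ p.
have k0 : 0 < k by rewrite !divr_gt0// powR_gt0.
have [||||N iN] := @int_dominated0 _ _ _ mu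
   (fun n x => `|f x - h n x| `^ p) (fun x => `|f x| `^ p) _ _ _ _ fp k k0.
- by move=> n; apply: (mpow (fun x => f x - h n x)); exact: measurable_funB.
- exact: mpow.
- move=> x; apply: cvg_powR0 => //; rewrite -(normr0 R) -(subrr (f x)).
  by apply: cvg_norm; apply: cvgB; [exact: cvg_cst|exact: cvh].
- by move=> n x; rewrite powR_ge0/= ge0_ler_powR ?nnegrE.
pose m := Num.bound p.
have pm : p <= m.+1%:R by rewrite ltW// (lt_trans (archi_boundP p0))// ltr_nat.
have mu1 : (\int[mu]_x (`|cst (1 : R) x| ^+ 0)%:E < +oo)%E.
  by have [_] := alg_moments (alg_cst 1).
have finmu : (\int[mu]_x (1 : R)%:E)%E \is a fin_num.
  by rewrite ge0_fin_numE ?int_ge0//; move: mu1; under eq_integral do rewrite expr0.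
set M := fine (\int[mu]_x (1 : R)%:E)%E in finmu.
have M0 : 0 <= M by rewrite fine_ge0// int_ge0.
pose eta := Num.min 1 (k / 2 / (M + 1)).
have M1 : 0 < M + 1 by rewrite ltr_wpDl.
have eta0 : 0 < eta by rewrite lt_min ltr01/= !divr_gt0.
have etap : eta `^ p * M < k / 2.
  have etaM : eta * (M + 1) <= k / 2.
    by rewrite -ler_pdivlMr// ge_min lexx orbT.
  have etap : eta `^ p <= eta by apply: ge1r_powR => //; rewrite eta0 ge_min lexx.
  apply: (@lt_le_trans _ _ (eta * (M + 1))) => //.
  apply: (@le_lt_trans _ _ (eta * M)); first by rewrite ler_wpM2r.
  by rewrite ltr_pM2l// ltrDl.
pose c := eta `^ p * eta ^- m.+1.
have c0 : 0 < c by rewrite mulr_gt0 ?powR_gt0 ?invr_gt0 ?exprn_gt0.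
have [a aa ia] := (ah N).2 m (k / 2 / c) (divr_gt0 (divr_gt0 k0 (ltr0n _ 2)) c0).
have [ma _] := alg_moments aa.
have mha : measurable_fun setT (fun x => h N x - a x) by exact: measurable_funB.
exists a => //.
have iap : (\int[mu]_x (`|h N x - a x| `^ p)%:E < k%:E)%E.
  apply: (@le_lt_trans _ _ (\int[mu]_x (eta `^ p * 1 + c * `|h N x - a x| ^+ m.+1)%:E)%E).
    apply: int_le => [||x|x].
    - exact: (mpow (fun x => h N x - a x)).
    - apply: measurable_funD => //; apply: measurable_funM => //.
      exact: (measurable_absX (h := fun x => h N x - a x)).
    - exact: powR_ge0.
    - by rewrite mulr1 powR_split// p0.
  rewrite int_lin ?powR_ge0 ?(ltW c0)//; try exact: (measurable_absX (h := fun x => h N x - a x)).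
  rewrite -(fineK finmu) -EFinM [k]splitr EFinD; apply: lteD => //.
  by rewrite muleC -lte_pdivlMr// -EFinM.
apply: (@le_lt_trans _ _ (\int[mu]_x
  (2 `^ p * `|f x - h N x| `^ p + 2 `^ p * `|h N x - a x| `^ p)%:E)%E).
  apply: int_le => [||x|x].
  - by apply: (mpow (fun x => f x - a x)); exact: measurable_funB.
  - apply: measurable_funD; apply: measurable_funM => //.
      by apply: (mpow (fun x => f x - h N x)); exact: measurable_funB.
    exact: (mpow (fun x => h N x - a x)).
  - exact: powR_ge0.
  - have -> : f x - a x = (f x - h N x) + (h N x - a x) by ring.
    by rewrite -mulrDr powRD_le.
rewrite int_lin ?powR_ge0//; first last.
- exact: (mpow (fun x => h N x - a x)).
- by apply: (mpow (fun x => f x - h N x)); exact: measurable_funB.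
have -> : (e%:E = (2 `^ p)%:E * k%:E + (2 `^ p)%:E * k%:E)%E.
  rewrite -!EFinM -EFinD /k; congr EFin; rewrite mulrC divfK ?gt_eqF ?powR_gt0//.
  by rewrite -splitr.
by apply: lteD; rewrite lte_pmul2l// lte_fin powR_gt0.
Qed.

End closure.

(** * Riemann-Stieltjes integrals from local expansions *)

Section partitions.
Context {R : realType}.
Implicit Types (a b t : R) (p : seq R).

Lemma last_pnode a p : last a p = pnode a p (size p).
Proof. by rewrite /pnode nth_last. Qed.

Lemma pnode_last a b p : itv_partition a b p -> pnode a p (size p) = b.
Proof. by move=> [_ /eqP <-]; rewrite last_pnode. Qed.

Lemma pnode_ltS a b p k : itv_partition a b p -> (k < size p)%N ->
  pnode a p k < pnode a p k.+1.
Proof. by move=> [/(pathP a) ap _] kp; exact: ap. Qed.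

Lemma pnode_le a b p k l : itv_partition a b p -> (k <= l <= size p)%N ->
  pnode a p k <= pnode a p l.
Proof.
move=> ip /andP[]; elim: l => [|l ih]; first by rewrite leqn0 => /eqP ->.
rewrite leq_eqVlt => /orP[/eqP -> //|kl] lp.
by apply: le_trans (ltW (pnode_ltS ip lp)); apply: ih => //; exact: ltnW.
Qed.

Lemma pnode_mesh a p k : (k < size p)%N ->
  pnode a p k.+1 - pnode a p k <= mesh a p.
Proof.
move=> kp; rewrite /mesh.
exact: (le_bigmax _ (fun k : 'I_(size p) => pnode a p k.+1 - pnode a p k) (Ordinal kp)).
Qed.

(** Riemann-Stieltjes integrals are unique because such partitions exist. *)
Lemma fine_partition t e : 0 <= t -> 0 < e -> exists2 p,
  itv_partition 0 t p & mesh 0 p < e.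
Proof.
rewrite le_eqVlt => /predU1P[<- e0|t0 e0].
  by exists [::]; rewrite /itv_partition//= /mesh big_ord0.
pose n := (Num.bound (t / e)).+1; pose h := t / n%:R.
have h0 : 0 < h by rewrite divr_gt0.
have he : h < e.
  rewrite ltr_pdivrMr// mulrC -ltr_pdivrMr//.
  apply: lt_le_trans (archi_boundP _) _; first by rewrite divr_ge0// ltW.
  by rewrite ler_nat.
pose p := mkseq (fun k => k.+1%:R * h) n.
have pk k : (k <= n)%N -> pnode 0 p k = k%:R * h.
  by case: k => [|k] kn; rewrite /pnode/= ?mul0r ?nth_mkseq.
have sp : size p = n by rewrite size_mkseq.
exists p.
  split; last first.
    by rewrite last_pnode sp pk// mulrC divfK// pnatr_eq0.
  apply/(pathP 0) => k; rewrite sp => kn.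
  suff : pnode 0 p k < pnode 0 p k.+1 by [].
  by rewrite (pk k (ltnW kn)) (pk k.+1 kn) ltr_pM2r// ltr_nat.
rewrite /mesh; apply/bigmax_ltP; split => // k _.
move: (ltn_ord k); rewrite [X in (_ < X)%N]sp => kn.
by rewrite (pk k (ltnW kn)) (pk k.+1 kn) -mulrBl -natrB// subSnn mul1r.
Qed.

End partitions.

Section germs.
Context {R : realType}.
Variable T : R.
Hypothesis T0 : 0 < T.
Implicit Types (f g H : R -> R) (A : R -> R -> R -> R).

(** H is determined up to a constant by its local expansion A: the error is of
    second order, so that it disappears when it is summed over a partition. *)
Definition germ A H := exists C : R, forall s x u,
  0 <= s -> s <= x -> x <= u -> u <= T ->
  `|H u - H s - A s x u| <= C * (u - s) ^+ 2.

(** The local expansion of the integral of f against g. *)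
Definition dform f g : R -> R -> R -> R := fun s x u => f x * (g u - g s).

Definition lip f := exists2 C : R, 0 <= C & forall s u,
  0 <= s -> s <= u -> u <= T -> `|f u - f s| <= C * (u - s).

Lemma lip_bounded f : lip f ->
  exists2 B : R, 0 <= B & forall s, 0 <= s <= T -> `|f s| <= B.
Proof.
move=> [C C0 fC]; exists (`|f 0| + C * T); first by rewrite addr_ge0 ?mulr_ge0 ?(ltW T0).
move=> s /andP[s0 sT]; rewrite -(subrK (f 0) (f s)) addrC.
apply: le_trans (ler_normD _ _) _; rewrite lerD2l.
by apply: le_trans (fC _ _ _ _ _) _ => //; rewrite subr0 ler_wpM2l.
Qed.

Lemma lip_dist f : lip f -> exists2 C : R, 0 <= C & forall x y,
  0 <= x <= T -> 0 <= y <= T -> `|f x - f y| <= C * `|x - y|.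
Proof.
move=> [C C0 fC]; exists C => // x y /andP[x0 xT] /andP[y0 yT].
case: (leP x y) => [xy|/ltW yx]; last by rewrite [`|x - y|]ger0_norm ?subr_ge0// fC.
by rewrite distrC [`|x - y|]distrC [`|y - x|]ger0_norm ?subr_ge0// fC.
Qed.

Lemma lip_cst c : lip (cst c).
Proof. by exists 0 => // s u *; rewrite subrr normr0 mul0r. Qed.

Lemma lip_id : lip id.
Proof. by exists 1 => // s u s0 su uT; rewrite mul1r ger0_norm// subr_ge0. Qed.

Lemma lipD f g : lip f -> lip g -> lip (fun x => f x + g x).
Proof.
move=> [C C0 fC] [D D0 gD]; exists (C + D); first exact: addr_ge0.
move=> s u s0 su uT; rewrite opprD addrACA mulrDl.
by apply: le_trans (ler_normD _ _) _; rewrite lerD ?fC ?gD.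
Qed.

Lemma lipM f g : lip f -> lip g -> lip (fun x => f x * g x).
Proof.
move=> lf lg; have [B B0 fB] := lip_bounded lf; have [B' B'0 gB] := lip_bounded lg.
case: lf lg => [C C0 fC] [D D0 gD]; exists (B * D + B' * C).
  by rewrite addr_ge0// mulr_ge0.
move=> s u s0 su uT.
have -> : f u * g u - f s * g s = f u * (g u - g s) + g s * (f u - f s) by ring.
apply: le_trans (ler_normD _ _) _; rewrite !normrM mulrDl -!mulrA.
by rewrite lerD// ler_pM// ?fB ?gB ?fC ?gD//; apply/andP; split; lra.
Qed.

Lemma lip_sum (I : Type) (r : seq I) (F : I -> R -> R) :
  (forall i, lip (F i)) -> lip (fun x => \sum_(i <- r) F i x).
Proof.
move=> lF; elim: r => [|i r ih].
  by under eq_fun do rewrite big_nil; exact: lip_cst.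
by under eq_fun do rewrite big_cons; exact: lipD.
Qed.

Lemma lip_ext f g : (forall x, 0 <= x <= T -> f x = g x) -> lip f -> lip g.
Proof.
move=> fg [C C0 fC]; exists C => // s u s0 su uT.
by rewrite -!fg ?fC//; apply/andP; split; lra.
Qed.

Lemma germ_ge0 A H : germ A H -> exists2 C : R, 0 <= C & forall s x u,
  0 <= s -> s <= x -> x <= u -> u <= T ->
  `|H u - H s - A s x u| <= C * (u - s) ^+ 2.
Proof.
move=> [C hC]; exists `|C| => // s x u *; apply: le_trans (hC s x u _ _ _ _) _ => //.
by rewrite ler_wpM2r ?sqr_ge0// ler_norm.
Qed.

Lemma germD A A' H H' : germ A H -> germ A' H' ->
  germ (fun s x u => A s x u + A' s x u) (fun t => H t + H' t).
Proof.
move=> [C hC] [C' hC']; exists (C + C') => s x u s0 sx xu uT.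
have -> : H u + H' u - (H s + H' s) - (A s x u + A' s x u) =
  (H u - H s - A s x u) + (H' u - H' s - A' s x u) by ring.
by rewrite mulrDl; apply: le_trans (ler_normD _ _) _; rewrite lerD ?hC ?hC'.
Qed.

Lemma germZ c A H : germ A H -> germ (fun s x u => c * A s x u) (fun t => c * H t).
Proof.
move=> [C hC]; exists (`|c| * C) => s x u s0 sx xu uT.
by rewrite -!mulrBr normrM -mulrA ler_wpM2l// hC.
Qed.

Lemma germ_ext A A' H H' : germ A H ->
  (forall s x u, 0 <= s -> s <= x -> x <= u -> u <= T -> A s x u = A' s x u) ->
  (forall t, 0 <= t <= T -> H t = H' t) -> germ A' H'.
Proof.
move=> [C hC] eA eH; exists C => s x u s0 sx xu uT.
by rewrite -eA// -!eH ?hC//; apply/andP; split; lra.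
Qed.

Lemma germ_cst0 : germ (fun _ _ _ => 0) (cst 0).
Proof. by exists 0 => *; rewrite !subr0 normr0 mul0r. Qed.

Lemma germ_sum (I : Type) (r : seq I) (A : I -> R -> R -> R -> R) (H : I -> R -> R) :
  (forall i, germ (A i) (H i)) ->
  germ (fun s x u => \sum_(i <- r) A i s x u) (fun t => \sum_(i <- r) H i t).
Proof.
move=> g; elim: r => [|i r ih].
  by apply: (germ_ext germ_cst0) => *; rewrite big_nil.
by apply: (germ_ext (germD (g i) ih)) => *; rewrite big_cons.
Qed.

Lemma germ_lip f g H : lip f -> lip g -> germ (dform f g) H -> lip H.
Proof.
move=> lf [L L0 gL] /germ_ge0[C C0 hC]; have [B B0 fB] := lip_bounded lf.
exists (C * T + B * L); first by rewrite addr_ge0// mulr_ge0// ltW.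
move=> s u s0 su uT; rewrite -(subrK (dform f g s s u) (H u - H s)) mulrDl.
apply: le_trans (ler_normD _ _) _; rewrite lerD//.
  apply: le_trans (hC _ _ _ _ _ _ _) _ => //; rewrite -mulrA ler_wpM2l//.
  by rewrite expr2 ler_wpM2r; lra.
by rewrite /dform normrM -mulrA ler_pM// ?fB ?gL//; apply/andP; split; lra.
Qed.

(** The Leibniz rule: the products of two increments are of second order. *)
Lemma germM f1 g1 H1 f2 g2 H2 : lip f1 -> lip g1 -> lip f2 -> lip g2 ->
  germ (dform f1 g1) H1 -> germ (dform f2 g2) H2 ->
  germ (fun s x u => dform (fun t => f1 t * H2 t) g1 s x u +
                     dform (fun t => H1 t * f2 t) g2 s x u)
       (fun t => H1 t * H2 t).
Proof.
move=> lf1 lg1 lf2 lg2 G1 G2.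
have lH1 := germ_lip lf1 lg1 G1; have lH2 := germ_lip lf2 lg2 G2.
have [B1 B10 b1] := lip_bounded lH1; have [B2 B20 b2] := lip_bounded lH2.
have [L1 L10 l1] := lip_dist lH1; have [L2 L20 l2] := lip_dist lH2.
have [C1 C10 c1] := germ_ge0 G1; have [C2 C20 c2] := germ_ge0 G2.
case: lH1 => D1 D10 d1; case: lH2 => D2 D20 d2.
exists (L1 * D2 + B1 * C2 + L2 * D1 + B2 * C1) => s x u s0 sx xu uT.
have us0 : 0 <= u - s by lra.
rewrite /dform.
have -> : H1 u * H2 u - H1 s * H2 s -
   (f1 x * H2 x * (g1 u - g1 s) + H1 x * f2 x * (g2 u - g2 s)) =
   (H1 u - H1 x) * (H2 u - H2 s) + H1 x * (H2 u - H2 s - f2 x * (g2 u - g2 s))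
   + (H2 s - H2 x) * (H1 u - H1 s) + H2 x * (H1 u - H1 s - f1 x * (g1 u - g1 s)).
  by ring.
have hx : 0 <= x <= T by apply/andP; split; lra.
have hs : 0 <= s <= T by apply/andP; split; lra.
have hu : 0 <= u <= T by apply/andP; split; lra.
have -> : (L1 * D2 + B1 * C2 + L2 * D1 + B2 * C1) * (u - s) ^+ 2 =
  L1 * D2 * (u - s) ^+ 2 + B1 * C2 * (u - s) ^+ 2 + L2 * D1 * (u - s) ^+ 2 +
  B2 * C1 * (u - s) ^+ 2 by ring.
apply: le_trans (ler_normD _ _) _; apply: lerD; last first.
  rewrite normrM -mulrA; apply: ler_pM => //; first exact: b2.
  exact: c1.
apply: le_trans (ler_normD _ _) _; apply: lerD; last first.
  rewrite normrM expr2 mulrACA; apply: ler_pM => //; last by apply: d1 => //; lra.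
  apply: le_trans (l2 _ _ _ _) _ => //; apply: ler_wpM2l => //.
  by rewrite ler_norml; apply/andP; split; lra.
apply: le_trans (ler_normD _ _) _; apply: lerD; last first.
  rewrite normrM -mulrA; apply: ler_pM => //; first exact: b1.
  exact: c2.
rewrite normrM expr2 mulrACA; apply: ler_pM => //; last by apply: d2 => //; lra.
apply: le_trans (l1 _ _ _ _) _ => //; apply: ler_wpM2l => //.
by rewrite ler_norml; apply/andP; split; lra.
Qed.

(** The n + 1 second order errors over intervals of length t / (n + 1) add up to
    an error of order 1 / (n + 1). *)
Lemma germ_riemann A H : germ A H -> exists2 C : R, 0 <= C &
  forall t n, 0 <= t <= T ->
  `|\sum_(k < n.+1) A (k%:R / n.+1%:R * t) (k%:R / n.+1%:R * t) (k.+1%:R / n.+1%:R * t)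
    - (H t - H 0)| <= C * t ^+ 2 / n.+1%:R.
Proof.
move=> /germ_ge0[C C0 hC]; exists C => // t n /andP[t0 tT].
set tk := fun k : nat => k%:R / n.+1%:R * t.
have -> : H t - H 0 = \sum_(k < n.+1) (H (tk k.+1) - H (tk k)).
  rewrite -(big_mkord xpredT (fun k => H (tk k.+1) - H (tk k))) telescope_sumr//.
  by rewrite /tk divff// mul1r mul0r mul0r.
rewrite -sumrB; apply: le_trans (ler_norm_sum _ _ _) _.
have -> : C * t ^+ 2 / n.+1%:R = \sum_(k < n.+1) C * (t / n.+1%:R) ^+ 2.
  rewrite sumr_const card_ord -mulr_natr exprMn exprVn.
  by field.
apply: ler_sum => k _; rewrite -normrN opprB -/(tk k) -/(tk k.+1).
have -> : t / n.+1%:R = tk k.+1 - tk k.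
  by rewrite /tk -!mulrBl -natrB// subSnn mul1r mulrC.
have tkk : tk k <= tk k.+1.
  by rewrite /tk ler_wpM2r// ler_wpM2r ?invr_ge0// ler_nat.
apply: hC => //; first by rewrite /tk mulr_ge0// divr_ge0.
apply: le_trans tT; rewrite /tk -[leRHS]mul1r ler_wpM2r//.
by rewrite ler_pdivrMr// mul1r ler_nat.
Qed.

Lemma germ_cvg A H t : germ A H -> 0 <= t <= T ->
  (fun n => \sum_(k < n.+1) A (k%:R / n.+1%:R * t) (k%:R / n.+1%:R * t)
     (k.+1%:R / n.+1%:R * t)) @ \oo --> H t - H 0.
Proof.
move=> /germ_riemann[C C0 hC] tT; apply/cvgrPdist_lt => e e0.
have D0 : 0 <= C * t ^+ 2 by rewrite mulr_ge0// sqr_ge0.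
exists (Num.bound (C * t ^+ 2 / e)) => // n /= en.
rewrite distrC; apply: le_lt_trans (hC t n tT) _.
rewrite ltr_pdivrMr// [ltRHS]mulrC -ltr_pdivrMr//.
apply: lt_le_trans (archi_boundP _) _; first exact: divr_ge0 D0 (ltW e0).
by rewrite ler_nat ltnW.
Qed.

Lemma germ_unique A H H' t : germ A H -> germ A H' -> H 0 = H' 0 -> 0 <= t <= T ->
  H t = H' t.
Proof.
move=> g g' H0 tT.
have : H t - H 0 = H' t - H' 0 by exact: cvg_unique (germ_cvg g tT) (germ_cvg g' tT).
by rewrite H0 => /addIr.
Qed.

Lemma germ_bound f g H (B L t : R) : germ (dform f g) H ->
  (forall s, 0 <= s <= t -> `|f s| <= B) ->
  (forall s u, 0 <= s -> s <= u -> u <= T -> `|g u - g s| <= L * (u - s)) ->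
  0 <= t <= T -> `|H t - H 0| <= B * (L * t).
Proof.
move=> gH fB gL tT; have /andP[t0 tT'] := tT.
have cv := cvg_norm (germ_cvg gH tT) (FF := eventually_filter).
rewrite -(cvg_lim _ cv)//; apply: limr_le; first by apply/cvg_ex; eexists; exact: cv.
apply: nearW => n; apply: le_trans (ler_norm_sum _ _ _) _.
have -> : B * (L * t) = \sum_(k < n.+1) B * (L * (t / n.+1%:R)).
  by rewrite sumr_const card_ord -mulr_natr; field.
apply: ler_sum => k _; rewrite /dform normrM; set tk := fun k : nat => k%:R / n.+1%:R * t.
have tkt j : (j <= n.+1)%N -> 0 <= tk j <= t.
  move=> jn; rewrite /tk mulr_ge0 ?divr_ge0//= -[leRHS]mul1r ler_wpM2r//.
  by rewrite ler_pdivrMr// mul1r ler_nat.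
have tkk : tk k <= tk k.+1.
  by rewrite /tk ler_wpM2r// ler_wpM2r ?invr_ge0// ler_nat.
have -> : t / n.+1%:R = tk k.+1 - tk k.
  by rewrite /tk -!mulrBl -natrB// subSnn mul1r mulrC.
have /andP[k0 kt] := tkt k (ltnW (ltn_ord k)).
have /andP[k0' kt'] := tkt k.+1 (ltn_ord k).
apply: ler_pM => //; first by apply: fB; rewrite k0 kt.
by apply: gL => //; exact: le_trans tT'.
Qed.

(** The same summation over an arbitrary tagged partition: the errors add up to
    at most C * mesh * t. *)
Lemma germ_rs f g H t : germ (dform f g) H -> 0 <= t <= T ->
  is_rs_integral f g 0 t (H t - H 0).
Proof.
move=> /germ_ge0[C C0 hC] /andP[t0 tT] e e0.
exists (e / (C * t + 1)) => [|p xi ip meshp xip].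
  by rewrite divr_gt0// ltr_wpDl// mulr_ge0.
have -> : H t - H 0 = \sum_(k < size p) (H (pnode 0 p k.+1) - H (pnode 0 p k)).
  rewrite -(big_mkord xpredT (fun k => H (pnode 0 p k.+1) - H (pnode 0 p k))).
  by rewrite telescope_sumr// (pnode_last ip).
rewrite -sumrB; apply: le_lt_trans (ler_norm_sum _ _ _) _.
apply: (@le_lt_trans _ _ (\sum_(k < size p) C * mesh 0 p * (pnode 0 p k.+1 - pnode 0 p k))).
  apply: ler_sum => k _; rewrite -normrN opprB.
  have /andP[x1 x2] := xip k (ltn_ord k).
  apply: le_trans (hC _ _ _ _ x1 x2 _) _.
  - have : pnode 0 p 0 <= pnode 0 p k by apply: (pnode_le ip); rewrite leq0n ltnW.
    by rewrite {1}/pnode.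
  - by apply: le_trans tT; rewrite -(pnode_last ip); apply: (pnode_le ip); rewrite ltn_ord leqnn.
  - rewrite -mulrA ler_wpM2l// expr2 ler_wpM2r ?pnode_mesh//.
    by rewrite subr_ge0 ltW// (pnode_ltS ip).
rewrite -mulr_sumr.
have -> : \sum_(i < size p) (pnode 0 p i.+1 - pnode 0 p i) = t.
  rewrite -(big_mkord xpredT (fun k => pnode 0 p k.+1 - pnode 0 p k)) telescope_sumr//.
  by rewrite (pnode_last ip) /pnode/= subr0.
have m0 : 0 <= mesh 0 p by apply: bigmax_ge_id.
move: meshp; rewrite ltr_pdivlMr ?ltr_wpDl ?mulr_ge0// => h.
apply: le_lt_trans h; rewrite mulrDr mulr1 mulrAC mulrC -subr_ge0.
by rewrite addrAC subrr add0r.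
Qed.

Lemma rs_integral_unique f g t I I' : 0 <= t ->
  is_rs_integral f g 0 t I -> is_rs_integral f g 0 t I' -> I = I'.
Proof.
move=> t0 hI hI'; apply/eqP; rewrite -subr_eq0 -normr_le0 leNgt; apply/negP => d0.
have e0 : 0 < `|I - I'| / 2 by rewrite divr_gt0.
have [d1 d10 h1] := hI _ e0; have [d2 d20 h2] := hI' _ e0.
have [||p ip mp] := @fine_partition _ t (Num.min d1 d2) => //.
  by rewrite lt_min d10.
move: mp; rewrite lt_min => /andP[m1 m2].
have xip k : (k < size p)%N -> pnode 0 p k <= pnode 0 p k <= pnode 0 p k.+1.
  by move=> kp; rewrite lexx/= ltW// (pnode_ltS ip).
have := h1 p (pnode 0 p) ip m1 xip; have := h2 p (pnode 0 p) ip m2 xip.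
set S := \sum_(k < _) _; rewrite -[`|S - I|]distrC => a b.
have := ltrD b a; rewrite -splitr => /(le_lt_trans (ler_normD _ _)).
by rewrite addrA subrK ltxx.
Qed.

Lemma germ_rs_integral f g H t : germ (dform f g) H -> 0 <= t <= T ->
  rs_integral f g 0 t = H t - H 0.
Proof.
move=> gH tT; have /andP[t0 _] := tT; rewrite /rs_integral; case: xgetP => [I -> hI|].
  exact: (rs_integral_unique t0 hI (germ_rs gH tT)).
by move=> /(_ (H t - H 0)) []; exact: germ_rs.
Qed.

End germs.

(** * Iterated integrals of piecewise linear paths *)

Section primitives.
Context {R : realType}.
Variable T : R.
Hypothesis T0 : 0 < T.
Implicit Types (f F : R -> R).

(** The increment of F over a part [s', u'] of [s, u] is compared with f at a
    point of [s, u]: integrating against t |-> min t a only sees a part of an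
    interval that contains a. *)
Definition primitive f F := exists2 L : R, 0 <= L & forall s x u s' u',
  0 <= s -> s <= x -> x <= u -> u <= T -> s <= s' -> s' <= u' -> u' <= u ->
  `|F u' - F s' - f x * (u' - s')| <= L * (u - s) * (u' - s').

Lemma derive_primitive f F : lip T f ->
  (forall x : R, 0 <= x <= T -> is_derive x 1 F (f x)) -> primitive f F.
Proof.
move=> /(lip_dist) [L L0 fL] dF; exists L => // s x u s' u' s0 sx xu uT ss' s'u' u'u.
have [||c] := @MVT_segment _ F f s' u' s'u'.
- by move=> y; rewrite in_itv/= => /andP[y1 y2]; apply: dF; apply/andP; split; lra.
- apply: derivable_within_continuous => y; rewrite in_itv/= => /andP[y1 y2].
  by have [] : is_derive y 1 F (f y) by apply: dF; apply/andP; split; lra.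
rewrite in_itv/= => /andP[c1 c2] ->; rewrite -mulrBl normrM [`|u' - s'|]ger0_norm ?subr_ge0//.
rewrite ler_wpM2r ?subr_ge0//; apply: le_trans (fL _ _ _ _) _; try by apply/andP; split; lra.
by rewrite ler_wpM2l// ler_norml; apply/andP; split; lra.
Qed.

(** Extends a function on [0, T] to a continuous function on the line. *)
Definition clip (x : R) := Num.max 0 (Num.min x T).

Lemma clip_itv x : 0 <= clip x <= T.
Proof. by rewrite /clip le_max lexx/= ge_max (ltW T0) ge_min lexx orbT. Qed.

Lemma clip_id x : 0 <= x <= T -> clip x = x.
Proof. by move=> /andP[x0 xT]; rewrite /clip (min_idPl xT) (max_idPr x0). Qed.

Lemma clip_dist x y : `|clip x - clip y| <= `|x - y|.
Proof.
wlog xy : x y / x <= y.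
  by move=> h; have [/h//|/ltW/h] := leP x y; rewrite distrC [`|y - x|]distrC.
rewrite distrC [`|x - y|]distrC [`|y - x|]ger0_norm ?subr_ge0//.
have T1 := T0; rewrite /clip ler_norml.
have [xT|xT] := leP x T; have [yT|yT] := leP y T; have [x1|x1] := leP 0 x;
  have [y1|y1] := leP 0 y; have [T2|T2] := leP 0 T; by apply/andP; split; lra.
Qed.

Lemma continuous_clip f : lip T f -> continuous (f \o clip).
Proof.
move=> /lip_dist[L L0 fL] x; apply/cvgrPdist_le => e e0.
have L1 : 0 < L + 1 by rewrite ltr_wpDl.
near=> y; change (`|f (clip x) - f (clip y)| <= e).
apply: le_trans (fL _ _ (clip_itv _) (clip_itv _)) _.
apply: le_trans (ler_wpM2l L0 (clip_dist _ _)) _.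
apply: (@le_trans _ _ ((L + 1) * `|x - y|)); first by rewrite ler_wpM2r// lerDl.
rewrite mulrC -ler_pdivlMr//; near: y.
by apply: cvgr_dist_le; [exact: cvg_id|rewrite divr_gt0].
Unshelve. all: by end_near. Qed.

Lemma lip_primitive f : lip T f -> exists F, primitive f F.
Proof.
move=> lf; exists (fun y => \int[lebesgue_measure]_(t in [set` `[-1, y]]) (f \o clip) t).
apply: derive_primitive => // x /andP[x0 xT].
have [||||dF dFE] := @continuous_FTC1_closed _ (f \o clip) (-1) x (T + 1).
- by lra.
- apply: continuous_compact_integrable; first exact: segment_compact.
  by apply: continuous_subspaceT => y; exact: continuous_clip.
- by lra.
- exact: continuous_clip.
have -> : f x = (f \o clip) x by rewrite /= clip_id// x0.
by rewrite -dFE derive1E; exact: derivableP.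
Qed.

Lemma exprn_primitive n : primitive (fun x => n.+1%:R * x ^+ n) (fun x : R => x ^+ n.+1).
Proof.
apply: derive_primitive => [|x _].
  apply: lipM => //; first exact: lip_cst.
  elim: n => [|n ih]; first exact: (@lip_cst _ T 1).
  by under eq_fun do rewrite exprS; apply: lipM => //; exact: lip_id.
apply: DeriveDef; first exact: exprn_derivable.
by rewrite exp_derive [LHS]mulr1.
Qed.
Lemma primitive_min f F a : primitive f F ->
  germ T (dform f (fun t => Num.min t a)) (fun t => F (Num.min t a)).
Proof.
move=> [L L0 hF]; exists L => s x u s0 sx xu uT; rewrite /dform.
have [as_|sa] := ltP a s.
  rewrite [Num.min u a]min_r; last by lra.
  by rewrite !subrr mulr0 subrr normr0 mulr_ge0 ?sqr_ge0.
set v := Num.min u a.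
have sv : s <= v by rewrite le_min; apply/andP; split; lra.
have vu : v <= u by rewrite ge_min lexx.
apply: le_trans (hF s x u s v _ _ _ _ _ _ _) _ => //.
by rewrite -mulrA expr2 ler_wpM2l// ler_wpM2l; lra.
Qed.

End primitives.

Section piecewise_linear.
Context {R : realType} {d : nat}.
Variable T : R.
Hypothesis T0 : 0 < T.
Variables (m : nat) (nd : nat -> R).
Hypotheses (nd0 : nd 0%N = 0) (ndm : nd m = T).
Hypothesis nd_le : forall k, (k < m)%N -> nd k <= nd k.+1.

(** The length of the part of [0, t] that lies in the k-th interval: the
    coordinates of a piecewise linear path are the linear combinations of these
    functions, whose coefficients are the slopes. *)
Definition ramp k t := Num.min t (nd k.+1) - Num.min t (nd k).

Lemma nd_mono j k : (j <= k)%N -> (k <= m)%N -> nd j <= nd k.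
Proof.
elim: k => [|k ih]; first by rewrite leqn0 => /eqP ->.
rewrite leq_eqVlt => /orP[/eqP -> //|jk] km.
by apply: le_trans (nd_le km); apply: ih => //; exact: ltnW.
Qed.

Lemma min_lip (a s u : R) : s <= u ->
  0 <= Num.min u a - Num.min s a <= u - s.
Proof.
move=> su; have [ua|ua] := leP u a; have [sa|sa] := leP s a; apply/andP; split; lra.
Qed.

Lemma lip_min (a : R) : lip T (fun t => Num.min t a).
Proof.
exists 1 => // s u _ su _; have /andP[a0 a1] := min_lip a su.
by rewrite mul1r ger0_norm.
Qed.

Lemma ramp_mono k (s u : R) : (k < m)%N -> s <= u -> 0 <= ramp k u - ramp k s <= u - s.
Proof.
move=> km su; have := nd_le km; rewrite /ramp => ndk.
have [a|a] := leP u (nd k); have [b|b] := leP s (nd k);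
  have [c|c] := leP u (nd k.+1); have [e|e] := leP s (nd k.+1);
  by apply/andP; split; lra.
Qed.

Lemma sum_ramp t : 0 <= t <= T -> \sum_(k < m) ramp k t = t.
Proof.
move=> /andP[t0 tT]; rewrite -(big_mkord xpredT (fun k => ramp k t)) /ramp.
by rewrite (telescope_sumr (fun k => Num.min t (nd k)))// ndm nd0 (min_l tT) (min_r t0) subr0.
Qed.

Definition pl_path (V : nat -> 'I_d -> R) (Y : R -> 'rV[R]_d) :=
  forall t, 0 <= t <= T -> forall i, Y t 0 i = \sum_(k < m) V k i * ramp k t.

Lemma dform_pl V Y f i : pl_path V Y -> forall s x u, 0 <= s -> s <= x -> x <= u -> u <= T ->
  \sum_(k < m) V k i * (dform f (fun t => Num.min t (nd k.+1)) s x u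
    + (- 1) * dform f (fun t => Num.min t (nd k)) s x u) = dform f (fun t => Y t 0 i) s x u.
Proof.
move=> plY s x u s0 sx xu uT; rewrite /dform !plY; try by apply/andP; split; lra.
rewrite -sumrB mulr_sumr; apply: eq_bigr => k _; rewrite /ramp; ring.
Qed.

Lemma germ_pl_primitive V Y f F i : pl_path V Y -> primitive T f F ->
  germ T (dform f (fun t => Y t 0 i))
    (fun t => \sum_(k < m) V k i * (F (Num.min t (nd k.+1)) - F (Num.min t (nd k)))).
Proof.
move=> plY pF.
apply: (germ_ext (A := fun s x u => \sum_(k < m) V k i *
  (dform f (fun t => Num.min t (nd k.+1)) s x u
    + (- 1) * dform f (fun t => Num.min t (nd k)) s x u))); last by [].
- apply: germ_sum => k /=.
  have G1 := primitive_min (nd k.+1) pF.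
  have G2 := germZ (- 1) (primitive_min (nd k) pF).
  apply: (germ_ext (germZ (V k i) (germD G1 G2))) => // t _.
  by rewrite mulN1r.
- exact: dform_pl plY.
Qed.

Lemma pl_lip V Y i : pl_path V Y -> lip T (fun t => Y t 0 i).
Proof.
move=> plY; apply: (@lip_ext _ _ (fun t => \sum_(k < m) V k i * ramp k t)).
  by move=> t tT; rewrite plY.
apply: lip_sum => k; apply: lipM => //; first exact: lip_cst.
apply: lipD; first exact: lip_min.
under eq_fun do rewrite -mulN1r.
by apply: lipM => //; [exact: lip_cst|exact: lip_min].
Qed.

Lemma pl_lip_bound V Y i (L : R) : pl_path V Y -> \sum_(k < m) `|V k i| <= L ->
  forall s u, 0 <= s -> s <= u -> u <= T -> `|Y u 0 i - Y s 0 i| <= L * (u - s).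
Proof.
move=> plY VL s u s0 su uT; rewrite !plY; try by apply/andP; split; lra.
rewrite -sumrB; apply: le_trans (ler_norm_sum _ _ _) _.
apply: le_trans (_ : _ <= (\sum_(k < m) `|V k i|) * (u - s)) _; last first.
  by rewrite ler_wpM2r// subr_ge0.
rewrite mulr_suml; apply: ler_sum => k _; rewrite -mulrBr normrM ler_wpM2l//.
by have /andP[a b] := ramp_mono (ltn_ord k) su; rewrite ger0_norm.
Qed.

(** Iterated integrals remain Lipschitz, so that the next integral exists: its
    local expansion has a solution because that of f dt has one. *)
Lemma iterated_integral_facts V Y (J : seq 'I_d) : pl_path V Y ->
  lip T (iterated_integral Y J) /\ forall i,
  germ T (dform (iterated_integral Y J) (fun t => Y t 0 i)) (iterated_integral Y (i :: J)).
Proof.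
move=> plY.
have step J' i : lip T (iterated_integral Y J') ->
    germ T (dform (iterated_integral Y J') (fun t => Y t 0 i)) (iterated_integral Y (i :: J')).
  move=> lJ; have [F pF] := lip_primitive T0 lJ; have gF := germ_pl_primitive i plY pF.
  set H := (H in germ _ _ H) in gF.
  apply: (germ_ext (germD gF (germ_cst0 T)) (H' := iterated_integral Y (i :: J')))  => //.
    by move=> *; rewrite addr0.
  have H0 : H 0 = 0.
    rewrite /H big1// => k _; rewrite !min_l ?subrr ?mulr0//.
      by rewrite -nd0 nd_mono// ltnW.
    by rewrite -nd0 nd_mono.
  by move=> t tT; rewrite /= (germ_rs_integral gF tT) H0 addr0 subr0.
elim: J => [|i J [lJ gJ]]; first by split; [exact: lip_cst|move=> i; apply: step; exact: lip_cst].
have lJ' : lip T (iterated_integral Y (i :: J)) by exact: germ_lip lJ (pl_lip i plY) (gJ i).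
by split => // j; exact: step.
Qed.

Lemma iterated_integral0 V Y i J : pl_path V Y -> iterated_integral Y (i :: J) 0 = 0.
Proof.
move=> plY; have [_ /(_ i) gJ] := iterated_integral_facts J plY.
have := germ_rs_integral gJ (t := 0); rewrite lexx (ltW T0) subrr => /(_ isT).
by [].
Qed.

(** L bounds the slopes, hence L * T bounds the variation of each coordinate. *)
Lemma iterated_integral_bound V Y (L : R) J t : pl_path V Y ->
  (forall i, \sum_(k < m) `|V k i| <= L) -> 0 <= t <= T ->
  `|iterated_integral Y J t| <= (L * T) ^+ size J.
Proof.
move=> plY VL tT; have /andP[t0 tT'] := tT.
have [->|d0] := eqVneq J [::]; first by rewrite /= normr1.
have L0 : 0 <= L.
  by case: J d0 => // i J _; apply: le_trans (VL i); apply: sumr_ge0.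
elim: J t tT t0 tT' {d0} => [|i J ih] t tT t0 tT'; first by rewrite /= normr1.
have [_ /(_ i) gJ] := iterated_integral_facts J plY.
have := germ_bound (B := (L * T) ^+ size J) (L := L) gJ _ _ tT.
rewrite (iterated_integral0 i J plY) subr0 => h.
apply: le_trans (h _ _) _.
- by move=> s /andP[s0 st]; apply: ih => //; [apply/andP; split => //|]; exact: le_trans tT'.
- exact: pl_lip_bound plY (VL i).
- by rewrite exprSr ler_wpM2l ?exprn_ge0 ?mulr_ge0 ?(ltW T0)// ler_wpM2l.
Qed.

(** By induction on the words, both sides have the same local expansion by the
    Leibniz rule, and both vanish at 0. The list s depends neither on the path
    nor on the time, which density needs. *)
Lemma shuffle I J : exists s : seq (seq 'I_d), forall V Y t, pl_path V Y -> 0 <= t <= T ->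
  iterated_integral Y I t * iterated_integral Y J t =
  \sum_(K <- s) iterated_integral Y K t.
Proof.
move: {2}(size I + size J)%N (leqnn (size I + size J)) => N.
elim: N I J => [|N ih] I J.
  rewrite leqn0 addn_eq0 !size_eq0 => /andP[/eqP -> /eqP ->]; exists [:: [::]] => V Y t _ _.
  by rewrite big_seq1 /= mulr1.
case: I => [|i I]; first by exists [:: J] => V Y t _ _; rewrite big_seq1 /= mul1r.
case: J => [|j J]; first by exists [:: i :: I] => V Y t _ _; rewrite big_seq1 /= mulr1.
rewrite /= addSn ltnS => sIJ.
have [s1 h1] := ih I (j :: J) sIJ.
have [s2 h2] : exists s : seq (seq 'I_d), forall V Y t, pl_path V Y -> 0 <= t <= T ->
  iterated_integral Y (i :: I) t * iterated_integral Y J t =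
  \sum_(K <- s) iterated_integral Y K t.
  by apply: ih; rewrite /= addSn -addnS.
exists (map (cons i) s1 ++ map (cons j) s2) => V Y t plY tT.
have [lI gI] := iterated_integral_facts I plY.
have [lJ gJ] := iterated_integral_facts J plY.
have gsum i' s : germ T (dform (fun t => \sum_(K <- s) iterated_integral Y K t) (fun t => Y t 0 i'))
    (fun t => \sum_(K <- s) iterated_integral Y (i' :: K) t).
  apply: (germ_ext (A := fun s' x u =>
    \sum_(K <- s) dform (iterated_integral Y K) (fun t => Y t 0 i') s' x u)) => //.
    by apply: germ_sum => K; have [_] := iterated_integral_facts K plY.
  by move=> *; rewrite /dform mulr_suml.
have G := germM T0 lI (pl_lip i plY) lJ (pl_lip j plY) (gI i) (gJ j).
have G' := germD (gsum i s1) (gsum j s2).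
have := germ_unique G (H' := fun t =>
  \sum_(K <- map (cons i) s1 ++ map (cons j) s2) iterated_integral Y K t).
apply => //.
  apply: (germ_ext G') => [s x u s0 sx xu uT|t' _].
    have hx : 0 <= x <= T by apply/andP; split; lra.
    by rewrite /dform -(h1 V)// -(h2 V).
  by rewrite big_cat !big_map.
rewrite !(iterated_integral0 _ _ plY) mulr0 big_cat/= !big_map.
by rewrite !big1 ?addr0// => K _; rewrite (iterated_integral0 _ _ plY).
Qed.

End piecewise_linear.

(** * Linear combinations of iterated integrals *)

Section polynomial_approximation.
Context {R : realType}.
Implicit Types x t : R.

Fixpoint abs_poly (n : nat) : {poly R} :=
  if n is n'.+1 then abs_poly n' + (2^-1)%:P * ('X ^+ 2 - abs_poly n' ^+ 2) else 0.

(** The error of the iteration is multiplied by 1 - (|x| + p(x)) / 2. *)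
Lemma abs_poly_error n x : `|x| <= 1 ->
  0 <= (abs_poly n).[x] /\ 0 <= `|x| - (abs_poly n).[x] <= `|x| * (1 - `|x| / 2) ^+ n.
Proof.
move=> x1; have x0 := normr_ge0 x; elim: n => [|n [p0 /andP[e0 e1]]].
  by rewrite /= hornerE subr0 expr0 mulr1 lexx x0.
rewrite /= !hornerE -[x ^+ 2](real_normK (num_real x)).
move: p0 e0 e1; set a := `|x| in x1 x0 *; set p := (abs_poly n).[x] => p0 e0 e1.
have f0 : 0 <= 1 - a / 2 by lra.
have -> : a - (p + 2^-1 * (a ^+ 2 - p ^+ 2)) = (a - p) * (1 - (a + p) / 2) by field.
split; first by nra.
apply/andP; split; first by apply: mulr_ge0 => //; lra.
rewrite exprSr mulrA; apply: ler_pM => //; lra.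
Qed.

Lemma cvg_abs_poly x : `|x| <= 1 -> (fun n => (abs_poly n).[x]) @ \oo --> `|x|.
Proof.
move=> x1; have x0 := normr_ge0 x.
apply: (@squeeze_cvgr _ _ _ _ (fun n => `|x| - `|x| * (1 - `|x| / 2) ^+ n) (cst `|x|)).
- apply: nearW => n; have [_ /andP[e0 e1]] := abs_poly_error n x1.
  by apply/andP; split; rewrite /cst; lra.
- rewrite -[X in _ --> X]subr0; apply: cvgB; first exact: cvg_cst.
  have [->|xn0] := eqVneq x 0.
    by rewrite normr0; under eq_fun do rewrite mul0r; exact: cvg_cst.
  rewrite -[X in _ --> X](mulr0 `|x|); apply: cvgM; first exact: cvg_cst.
  have x0' : 0 < `|x| by rewrite normr_gt0.
  by apply: cvg_expr; rewrite ger0_norm; lra.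
- exact: cvg_cst.
Qed.

(** min t c is an affine function of t minus |t - c| / 2, and |t - c| <= T. *)
Lemma min_poly (T c : R) : 0 < T -> 0 <= c <= T -> exists q : nat -> {poly R},
  forall t, 0 <= t <= T -> (fun n => (q n).[t]) @ \oo --> Num.min t c.
Proof.
move=> T0 /andP[c0 cT].
exists (fun n => (2^-1)%:P * ('X + c%:P - T%:P * (abs_poly n \Po ((T^-1)%:P * ('X - c%:P))))).
move=> t /andP[t0 tT]; under eq_fun do rewrite !hornerE horner_comp !hornerE.
have -> : Num.min t c = 2^-1 * (t + c - T * `|T^-1 * (t - c)|).
  rewrite normrM gtr0_norm ?invr_gt0// mulrA divff ?gt_eqF// mul1r.
  have [tc|tc] := leP t c; first by rewrite ler0_norm; lra.
  by rewrite gtr0_norm; lra.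
apply: cvgM; first exact: cvg_cst.
apply: cvgB; first exact: cvg_cst.
apply: cvgM; first exact: cvg_cst.
apply: cvg_abs_poly; rewrite normrM gtr0_norm ?invr_gt0// mulrC ler_pdivrMr// mul1r.
by rewrite ler_norml; apply/andP; split; lra.
Qed.

End polynomial_approximation.

Section word_combinations.
Context {R : realType} {d : nat}.
Variable T : R.
Hypothesis T0 : 0 < T.
Variables (m : nat) (nd : nat -> R).
Hypotheses (nd0 : nd 0%N = 0) (ndm : nd m = T).
Hypothesis nd_le : forall k, (k < m)%N -> nd k <= nd k.+1.
Variable o : 'I_d.
Implicit Types (s : seq (R * seq 'I_d)) (Y : R -> 'rV[R]_d) (V : nat -> 'I_d -> R).

Local Notation pl := (pl_path T m nd).

Definition time_coord V := forall k, V k o = 1.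

Definition word_comb s Y t := \sum_(x <- s) x.1 * iterated_integral Y x.2 t.

Lemma word_comb_cst c Y t : word_comb [:: (c, [::])] Y t = c.
Proof. by rewrite /word_comb big_seq1/= mulr1. Qed.

Lemma word_comb_cons x s Y t :
  word_comb (x :: s) Y t = x.1 * iterated_integral Y x.2 t + word_comb s Y t.
Proof. by rewrite /word_comb big_cons. Qed.

Lemma word_combD s s' Y t : word_comb (s ++ s') Y t = word_comb s Y t + word_comb s' Y t.
Proof. by rewrite /word_comb big_cat. Qed.

Lemma word_combM s s' : exists s'', forall V Y t, pl V Y -> 0 <= t <= T ->
  word_comb s'' Y t = word_comb s Y t * word_comb s' Y t.
Proof.
elim: s => [|[c I] s [s1 h1]].
  by exists [::] => *; rewrite /word_comb !big_nil mul0r.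
have [s2 h2] : exists s2, forall V Y t, pl V Y -> 0 <= t <= T ->
    word_comb s2 Y t = c * iterated_integral Y I t * word_comb s' Y t.
  elim: s' {h1} => [|[c' J] s' [s2 h2]].
    by exists [::] => *; rewrite /word_comb !big_nil mulr0.
  have [r hr] := shuffle T0 nd0 nd_le I J.
  exists ([seq (c * c', K) | K <- r] ++ s2) => V Y t plY tT.
  rewrite word_combD (h2 V)// {1}/word_comb big_map/= -mulr_sumr -(hr V)//.
  by rewrite word_comb_cons/=; ring.
exists (s2 ++ s1) => V Y t plY tT.
by rewrite word_combD (h1 V)// (h2 V)// word_comb_cons mulrDl.
Qed.

Definition word_comb_int i s := [seq (x.1, i :: x.2) | x <- s].

Lemma word_comb_int_germ i s V Y : pl V Y ->
  germ T (dform (word_comb s Y) (fun t => Y t 0 i)) (word_comb (word_comb_int i s) Y).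
Proof.
move=> plY; apply: (germ_ext (A := fun r x u => \sum_(w <- s) w.1 *
    dform (iterated_integral Y w.2) (fun t => Y t 0 i) r x u)
    (H := fun t => \sum_(w <- s) w.1 * iterated_integral Y (i :: w.2) t)).
- apply: germ_sum => w; have [_ /(_ i) g] := iterated_integral_facts T0 nd0 nd_le w.2 plY.
  exact: germZ g.
- by move=> *; rewrite /dform /word_comb mulr_suml; apply: eq_bigr => w _; rewrite mulrA.
- by move=> t _; rewrite /word_comb big_map.
Qed.

Lemma word_comb_int0 i s V Y : pl V Y -> word_comb (word_comb_int i s) Y 0 = 0.
Proof.
move=> plY; rewrite /word_comb big_map big1// => w _.
by rewrite (iterated_integral0 T0 nd0 nd_le _ _ plY) mulr0.
Qed.

Lemma word_comb_time V Y t : pl V Y -> time_coord V -> 0 <= t <= T ->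
  word_comb [:: (1, [:: o])] Y t = t.
Proof.
move=> plY tV tT.
have Yo u : 0 <= u <= T -> Y u 0 o = u.
  move=> uT; rewrite plY//; under eq_bigr do rewrite tV mul1r.
  exact: sum_ramp nd0 ndm _ uT.
have g := word_comb_int_germ o [:: (1, [::])] plY.
apply: (germ_unique (H' := id) g) => //; last exact: word_comb_int0 plY.
apply: (germ_ext (A := dform (cst 1) id) (H := id)).
- exists 0 => s x u *; rewrite (_ : id u - id s - _ = 0) ?normr0 ?mul0r//.
  by rewrite /dform/= mul1r subrr.
- move=> s x u s0 sx xu uT; rewrite /dform word_comb_cst !Yo//; by apply/andP; split; lra.
- by [].
Qed.

Lemma word_comb_timeX n : exists s, forall V Y t, pl V Y -> time_coord V -> 0 <= t <= T ->
  word_comb s Y t = t ^+ n.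
Proof.
elim: n => [|n [s hs]].
  by exists [:: (1, [::])] => V Y t *; rewrite word_comb_cst.
have [s' hs'] := word_combM [:: (1, [:: o])] s; exists s' => V Y t plY tV tT.
by rewrite (hs' V)// (hs V)// (word_comb_time plY)// exprS.
Qed.

(** The integral of q' against the i-th coordinate of the path with slopes V; it
    makes sense for every q, in particular for limits of polynomials. *)
Definition pl_integral i (q : R -> R) V t :=
  \sum_(k < m) V k i * (q (Num.min t (nd k.+1)) - q (Num.min t (nd k))).

Lemma word_comb_exprn_int i n : exists s, forall V Y t, pl V Y -> time_coord V ->
  0 <= t <= T -> word_comb s Y t = pl_integral i (fun x => x ^+ n) V t.
Proof.
case: n => [|n].
  exists [::] => V Y t *; rewrite /word_comb big_nil /pl_integral big1// => k _.
  by rewrite !expr0 subrr mulr0.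
have [s hs] := word_comb_timeX n.
have [s' hs'] := word_combM [:: (n.+1%:R, [::])] s.
exists (word_comb_int i s') => V Y t plY tV tT.
have g := word_comb_int_germ i s' plY.
have g' := germ_pl_primitive i plY (exprn_primitive T0 n).
apply: (germ_unique (H' := pl_integral i (fun x => x ^+ n.+1) V) g) => //.
  apply: (germ_ext g') => // s1 x u s0 sx xu uT.
  have xT : 0 <= x <= T by apply/andP; split; lra.
  by rewrite /dform (hs' V)// word_comb_cst (hs V).
rewrite (word_comb_int0 _ _ plY) /pl_integral big1// => k _.
rewrite !min_l ?subrr ?mulr0// -nd0 (nd_mono nd_le)//.
exact: ltnW.
Qed.

Lemma word_comb_pl_integral i (q : {poly R}) : exists s, forall V Y t, pl V Y ->
  time_coord V -> 0 <= t <= T -> word_comb s Y t = pl_integral i (horner q) V t.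
Proof.
have [s hs] : exists s, forall V Y t, pl V Y -> time_coord V -> 0 <= t <= T ->
    word_comb s Y t = pl_integral i (fun x => \sum_(j < size q) q`_j * x ^+ j) V t.
  elim: (size q) => [|n [s hs]].
    exists [::] => V Y t *; rewrite /word_comb big_nil /pl_integral big1// => k _.
    by rewrite !big_ord0 subrr mulr0.
  have [s1 h1] := word_comb_exprn_int i n.
  have [s2 h2] := word_combM [:: (q`_n, [::])] s1.
  exists (s ++ s2) => V Y t plY tV tT.
  rewrite word_combD (hs V)// (h2 V)// word_comb_cst (h1 V)// /pl_integral mulr_sumr -big_split/=.
  by apply: eq_bigr => k _; rewrite !big_ord_recr/=; ring.
exists s => V Y t plY tV tT; rewrite (hs V)//; apply: eq_bigr => k _.
by rewrite !horner_coef.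
Qed.

Lemma lip_horner (q : {poly R}) : lip T (horner q).
Proof.
apply: (@lip_ext _ _ (fun x => \sum_(j < size q) q`_j * x ^+ j)).
  by move=> x _; rewrite horner_coef.
apply: lip_sum => j; apply: lipM => //; first exact: lip_cst.
elim: (nat_of_ord j) => [|n ih]; first exact: (@lip_cst _ T 1).
by under eq_fun do rewrite exprS; apply: lipM => //; exact: lip_id.
Qed.

Lemma min_itv t k : (k <= m)%N -> 0 <= t <= T -> 0 <= Num.min t (nd k) <= T.
Proof.
move=> km /andP[t0 tT]; rewrite le_min t0 -{1}nd0 (nd_mono nd_le)//=.
by rewrite ge_min tT.
Qed.

Lemma pl_integral_bound i (q : {poly R}) : exists2 C : R, 0 <= C & forall V t, 0 <= t <= T ->
  `|pl_integral i (horner q) V t| <= C * \sum_(k < m) `|V k i|.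
Proof.
have [B B0 hB] := lip_bounded T0 (lip_horner q).
exists (B + B) => [|V t tT]; first exact: addr_ge0.
apply: le_trans (ler_norm_sum _ _ _) _; rewrite mulr_sumr; apply: ler_sum => k _.
rewrite normrM mulrC ler_wpM2r//; apply: le_trans (ler_normB _ _) _.
by rewrite lerD// hB// min_itv// ltnW.
Qed.

Lemma ramp_eq0 l x : (l < m)%N -> x <= nd l -> ramp nd l x = 0.
Proof.
by move=> lm xl; rewrite /ramp !min_l ?subrr//; exact: le_trans (nd_le lm).
Qed.

Lemma ramp_min l x c : (l < m)%N -> nd l.+1 <= c -> ramp nd l (Num.min x c) = ramp nd l x.
Proof.
move=> lm lc; rewrite /ramp -!minA [Num.min c (nd l.+1)]min_r// [Num.min c (nd l)]min_r//.
exact: le_trans (nd_le lm) lc.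
Qed.

(** A ramp grows on one interval only, hence selects one slope. *)
Lemma pl_integral_ramp i l V t : (l < m)%N -> 0 <= t <= T ->
  pl_integral i (ramp nd l) V t = V l i * ramp nd l t.
Proof.
move=> lm tT; rewrite /pl_integral (bigD1 (Ordinal lm))//= big1 ?addr0.
  rewrite (ramp_min _ lm (lexx _)) [ramp nd l (Num.min t (nd l))]ramp_eq0 ?subr0//.
  by rewrite ge_min lexx orbT.
move=> k kl; have km := ltn_ord k.
have : (k.+1 <= l)%N \/ (l.+1 <= k)%N.
  by case: (ltngtP (k : nat) l) => [| |e]; [left|right|]; rewrite // -val_eqE/= e eqxx in kl.
case=> [k_l|l_k].
- rewrite !ramp_eq0 ?subrr ?mulr0// ge_min.
    by rewrite (nd_mono nd_le (ltnW k_l) (ltnW lm)) orbT.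
  by rewrite (nd_mono nd_le k_l (ltnW lm)) orbT.
- have lk := nd_mono nd_le l_k (ltnW km).
  by rewrite !ramp_min ?subrr ?mulr0//; exact: le_trans lk (nd_le km).
Qed.

(** Polynomials that converge to a ramp isolate the slope that it selects. *)
Lemma word_comb_slope i l : (l < m)%N -> exists q : nat -> {poly R},
  forall V t, 0 <= t <= T -> (fun n => pl_integral i (horner (q n)) V t) @ \oo --> V l i * ramp nd l t.
Proof.
move=> lm.
have nT k : (k <= m)%N -> 0 <= nd k <= T.
  move=> km; apply/andP; split; first by rewrite -nd0 (nd_mono nd_le).
  by rewrite -ndm (nd_mono nd_le).
have [q1 h1] := min_poly T0 (nT _ lm).
have [q2 h2] := min_poly T0 (nT _ (ltnW lm)).
exists (fun n => q1 n - q2 n) => V t tT; rewrite -pl_integral_ramp//.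
apply: cvg_big => [|k _]; first exact: add_continuous.
apply: cvgM; first exact: cvg_cst.
have hk x : 0 <= x <= T -> (fun n => (q1 n - q2 n).[x]) @ \oo --> ramp nd l x.
  move=> xT; under eq_fun do rewrite hornerD hornerN.
  by apply: cvgB; [exact: h1|exact: h2].
by apply: cvgB; apply: hk; apply: min_itv => //; exact: ltnW.
Qed.

(** Words are stored from the outermost integrator to the innermost, and several
    entries of s may carry the same word. *)
Lemma word_comb_sig s : exists N (l : seq 'I_d -> R), forall Y t,
  sig_functional N l Y t = word_comb s Y t.
Proof.
pose l s I := \sum_(x <- s | rev x.2 == I) x.1.
suff h N s' Y t : all (fun x => size x.2 <= N)%N s' ->
    sig_functional N (l s') Y t = word_comb s' Y t.
  exists (\max_(x <- s) size x.2), (l s) => Y t; apply: h.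
  apply/allP => x xs; rewrite (big_rem x)//= leq_maxl //.
elim: s' => [_|x s' ih /andP[xN /ih{}ih]].
  rewrite /sig_functional /word_comb big_nil big1// => k _; rewrite big1// => I _.
  by rewrite /l big_nil mul0r.
rewrite word_comb_cons -ih /sig_functional.
under eq_bigr => k _.
  under eq_bigr => I _.
    rewrite (_ : l (x :: s') I = (if rev x.2 == I then x.1 else 0) + l s' I); last first.
      by rewrite /l big_cons; case: ifP; rewrite ?add0r.
    rewrite mulrDl; over.
  rewrite big_split/=; over.
rewrite big_split/=; congr (_ + _).
have kN : (size x.2 < N.+1)%N by rewrite ltnS.
rewrite (bigD1 (Ordinal kN))//= [X in _ + X]big1 ?addr0 => [|k kx]; last first.
  apply: big1 => I _; case: eqP => [e|]; last by rewrite mul0r.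
  by case/eqP: kx; apply/val_inj; rewrite /= -size_rev e size_tuple.
rewrite (bigD1 (rev_tuple (in_tuple x.2)))//= [X in _ + X]big1 ?addr0 => [|I Ix]; last first.
  by case: eqP => [e|]; [move: Ix; rewrite -val_eqE/= e eqxx|rewrite mul0r].
by rewrite eqxx /signature revK.
Qed.

End word_combinations.

(** * Density for observables of a stopped path *)

Section countable_boxes.
Context {dE : measure_display} {E : measurableType dE} {R : realType}.

Lemma measurable_fun_lt (f : E -> R) :
  (forall c, measurable [set x | f x < c]) -> measurable_fun setT f.
Proof.
move=> mf; apply: (measurability _ (RGenInftyO.measurableE R)) => _ [_ [c ->] <-].
by rewrite setTI preimage_itvNyo; exact: mf.
Qed.

(** Each point has a rational box around it that the map sends into a given
    open set, and there are countably many such boxes. *)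
Lemma measurable_fun_borel (Z : pseudoPMetricType R) (I : finType)
    (v : E -> I -> R) (Phi : E -> Z) :
  (forall i, measurable_fun setT (v ^~ i)) ->
  (forall e (eps : R), 0 < eps -> exists2 delta : R, 0 < delta &
    forall e', (forall i, `|v e i - v e' i| < delta) -> ball (Phi e) eps (Phi e')) ->
  measurable_fun setT (Phi : E -> borel Z).
Proof.
move=> mv cPhi.
apply: (@measurability _ _ E (borel Z) setT Phi (@open Z)) => // _ [U oU <-].
rewrite setTI.
pose box (j : {ffun I -> rat} * nat) : set E :=
  [set e | forall i, `|v e i - ratr (j.1 i)| < j.2.+1%:R^-1].
have mbox j : measurable (box j).
  rewrite (_ : box j = \bigcap_(i : I) [set e | `|v e i - ratr (j.1 i)| < j.2.+1%:R^-1]).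
    apply: fin_bigcap_measurable => // i _.
    rewrite (_ : [set e | _] = (fun e => `|v e i - ratr (j.1 i)|) @^-1` `]-oo, j.2.+1%:R^-1[).
      rewrite -[X in measurable X]setTI.
      suff mvi : measurable_fun setT (fun e => `|v e i - ratr (j.1 i)|) by exact: mvi.
      by apply: measurableT_comp => //; apply: measurable_funB.
    by rewrite preimage_itvNyo.
  by apply/seteqP; split => [e he i _|e he i]; [exact: he|exact: he].
pose good n : set E := if unpickle n is Some j then
  (if `[< box j `<=` Phi @^-1` U >] then box j else set0) else set0.
rewrite (_ : Phi @^-1` U = \bigcup_n good n).
  apply: bigcup_measurable => n _; rewrite /good.
  by case: unpickle => // j; case: ifP => // _; exact: mbox.
apply/seteqP; split => [e Ue|e [n _]]; last first.
  rewrite /good; case: unpickle => // j; case: asboolP => // jU ej.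
  exact: jU.
have [eps eps0 epsU] : exists2 eps : R, 0 < eps & ball (Phi e) eps `<=` U.
  have : nbhs (Phi e) U by apply: open_nbhs_nbhs; split.
  by rewrite -nbhs_ballE => -[eps /= eps0 h]; exists eps.
have [delta delta0 hdelta] := cPhi e eps eps0.
pose N := Num.bound (2 / delta).
have N2 : N.+1%:R^-1 + N.+1%:R^-1 < delta.
  have h : 2 / delta < N.+1%:R.
    apply: lt_trans (archi_boundP _) _; first by rewrite divr_ge0// ltW.
    by rewrite ltr_nat.
  have -> : N.+1%:R^-1 + N.+1%:R^-1 = 2 / N.+1%:R :> R by rewrite mulr_natl mulr2n.
  by move: h; rewrite !ltr_pdivrMr// mulrC.
have N0 : 0 < N.+1%:R^-1 :> R by rewrite invr_gt0.
have rats i : exists q : rat, `|v e i - ratr q| < N.+1%:R^-1.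
  have [|q] := @rat_in_itvoo R (v e i) (v e i + N.+1%:R^-1); first by rewrite ltrDl.
  rewrite in_itv/= => /andP[q1 q2]; exists q.
  by rewrite distrC gtr0_norm ?subr_gt0// ltrBlDl.
pose q : {ffun I -> rat} := [ffun i => projT1 (cid (rats i))].
have ebox : box (q, N) e.
  by move=> i; rewrite /= ffunE; exact: projT2 (cid (rats i)).
exists (pickle (q, N)) => //; rewrite /good pickleK.
rewrite ifT//; apply/asboolP => e' e'box; apply: epsU; apply: hdelta => i.
apply: le_lt_trans N2; rewrite -(subrKA (ratr (q i))); apply: le_trans (ler_normD _ _) _.
by apply: lerD; apply: ltW; [exact: ebox|rewrite distrC; exact: e'box].
Qed.

End countable_boxes.

Section signature_density.
Context {dE : measure_display} {E : measurableType dE} {R : realType} {d : nat}.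
Variable mu : {measure set E -> \bar R}.
Variables (T : R) (m : nat) (nd : nat -> R) (o : 'I_d).
Hypothesis T0 : 0 < T.
Hypotheses (nd0 : nd 0%N = 0) (ndm : nd m = T).
Hypothesis nd_lt : forall k, (k < m)%N -> nd k < nd k.+1.
Variables (tau : E -> R) (V : E -> nat -> 'I_d -> R) (Y : E -> R -> 'rV[R]_d).
Hypotheses (mtau : measurable_fun setT tau) (tauT : forall e, 0 <= tau e <= T).
Hypothesis mV : forall k i, measurable_fun setT (fun e => V e k i).
Hypothesis tV : forall e, time_coord o (V e).
Hypothesis plY : forall e, pl_path T m nd (V e) (Y e).

Definition total_slope e := \sum_(k < m) \sum_i `|V e k i|.

Hypothesis exp_slope : has_exp_moments mu total_slope.

Let nd_le k : (k < m)%N -> nd k <= nd k.+1. Proof. by move=> /nd_lt/ltW. Qed.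

Definition sig_alg : set (E -> R) :=
  [set h | exists s, forall e, h e = word_comb s (Y e) (tau e)].

Lemma measurable_ramp k (t : E -> R) : measurable_fun setT t ->
  measurable_fun setT (fun e => ramp nd k (t e)).
Proof.
by move=> mt; apply: measurable_funB; apply: measurable_minr => //; exact: measurable_cst.
Qed.

Lemma measurable_Y i (t : E -> R) : measurable_fun setT t ->
  (forall e, 0 <= t e <= T) -> measurable_fun setT (fun e => Y e (t e) 0 i).
Proof.
move=> mt tT; under eq_fun do rewrite (plY _ (tT _)).
by apply: measurable_sum => k; apply: measurable_funM; [exact: mV|exact: measurable_ramp].
Qed.

(** A limit of Riemann sums, whose terms are measurable by induction because they
    evaluate a shorter iterated integral at a fraction of the time t. *)
Lemma measurable_iterated_integral J (t : E -> R) : measurable_fun setT t ->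
  (forall e, 0 <= t e <= T) -> measurable_fun setT (fun e => iterated_integral (Y e) J (t e)).
Proof.
elim: J t => [|i J ih] t mt tT; first exact: measurable_cst.
pose tk n k e := k%:R / n.+1%:R * t e.
have mtk n k : measurable_fun setT (tk n k) by apply: measurable_funM => //; exact: measurable_cst.
have tkT n k e : (k <= n.+1)%N -> 0 <= tk n k e <= T.
  have /andP[t0 t1] := tT e; move=> kn; rewrite /tk mulr_ge0 ?divr_ge0//=.
  apply: le_trans t1; rewrite -[leRHS]mul1r ler_wpM2r//.
  by rewrite ler_pdivrMr// mul1r ler_nat.
apply: (@measurable_fun_cvg _ _ _ _ (fun n e => \sum_(k < n.+1)
   iterated_integral (Y e) J (tk n k e) * (Y e (tk n k.+1 e) 0 i - Y e (tk n k e) 0 i))).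
  move=> n; apply: measurable_sum => k.
  have kn := ltn_ord k.
  apply: measurable_funM; first by apply: ih => // e; apply: tkT; exact: ltnW.
  by apply: measurable_funB; apply: measurable_Y => // e; apply: tkT => //; exact: ltnW.
move=> e _; have [_ /(_ i) g] := iterated_integral_facts T0 nd0 nd_le J (plY e).
have := germ_cvg g (tT e); rewrite (iterated_integral0 T0 nd0 nd_le _ _ (plY e)) subr0.
by apply.
Qed.

Lemma total_slope_ge0 e : 0 <= total_slope e.
Proof. by apply: sumr_ge0 => k _; apply: sumr_ge0. Qed.

Lemma slope_le e i : \sum_(k < m) `|V e k i| <= total_slope e.
Proof. by apply: ler_sum => k _; rewrite (bigD1 i)//= lerDl sumr_ge0. Qed.

Let moments_slope : has_moments mu total_slope.
Proof.
apply: has_moments_le (exp_has_moments 1 exp_slope) _; first by case: exp_slope.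
by move=> e; rewrite mul1r; apply: le_trans (expR_ge1Dx _); rewrite lerDr.
Qed.

Let has_moments_cst c : has_moments mu (cst c).
Proof.
split; first exact: measurable_cst.
move=> n; have := (exp_has_moments 0 exp_slope).2 0%N; under eq_integral do rewrite expr0.
rewrite integral_cst// mul1e => muT.
have -> : (\int[mu]_x (`|cst c x| ^+ n)%:E = (`|c| ^+ n)%:E * mu setT)%E by rewrite -integral_cst.
by apply: lte_mul_pinfty => //; rewrite lee_fin exprn_ge0.
Qed.

Lemma sig_alg_moments h : sig_alg h -> has_moments mu h.
Proof.
case=> s hs; have -> : h = fun e => word_comb s (Y e) (tau e) by exact/funext.
rewrite /word_comb; elim: s {hs} => [|[c J] s ih].
  by under eq_fun do rewrite big_nil; exact: has_moments_cst.
under eq_fun do rewrite big_cons; apply: has_momentsD => //=.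
apply: has_momentsM; first exact: has_moments_cst.
apply: (@has_moments_le _ _ _ _ _ (fun e => (total_slope e * T) ^+ size J)).
- exact: measurable_iterated_integral.
- elim: (size J) => [|n ihn]; first exact: (has_moments_cst 1).
  under eq_fun do rewrite exprS; apply: has_momentsM => //.
  by apply: has_momentsM => //; exact: has_moments_cst.
- move=> e; apply: (iterated_integral_bound T0 nd0 nd_le _ (plY e)) => // i.
  exact: slope_le.
Qed.

Lemma sig_alg_cst c : sig_alg (cst c).
Proof. by exists [:: (c, [::])] => e; rewrite word_comb_cst. Qed.

Lemma sig_algD h g : sig_alg h -> sig_alg g -> sig_alg (fun e => h e + g e).
Proof. by move=> [s hs] [s' hs']; exists (s ++ s') => e; rewrite word_combD hs hs'. Qed.

Lemma sig_algM h g : sig_alg h -> sig_alg g -> sig_alg (fun e => h e * g e).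
Proof.
move=> [s hs] [s' hs']; have [s'' h''] := word_combM T0 nd0 nd_le s s'.
by exists s'' => e; rewrite (h'' (V e))// hs hs'.
Qed.

Let approx := approximable_set mu sig_alg.
Let appT := g_sigma_algebraType approx.

(** A bound that is linear in the slopes gives exponential moments; iterated
    integrals of several path coordinates do not have them. *)
Lemma measurable_sig_alg h (C : R) : sig_alg h ->
  (forall e, `|h e| <= C * total_slope e + C) ->
  measurable_fun setT (h : appT -> R).
Proof.
move=> ah hC; apply: measurable_fun_lt => c.
rewrite (measurable_approximable sig_alg_moments sig_alg_cst sig_algD sig_algM).
apply: (approximable_set_lt sig_alg_moments sig_alg_cst sig_algD sig_algM) => //.
have [mh _] := sig_alg_moments ah; split => // k.
have [msl isl] := exp_slope.
apply: (@le_lt_trans _ _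
  (\int[mu]_x (expR (`|k| * C) * expR (`|k| * C * `|total_slope x|) + 0 * 0)%:E)%E).
  apply: int_le => [||x|x].
  - exact: measurable_exp_abs.
  - apply: measurable_funD => //; apply: measurable_funM => //.
    exact: measurable_exp_abs.
  - exact: expR_ge0.
  - rewrite mul0r addr0 -expRD ler_expR.
    apply: le_trans (ler_wpM2r _ (ler_norm k)) _ => //.
    rewrite -mulrA -mulrDr ler_wpM2l// [leRHS]addrC.
    by rewrite [`|total_slope x|]ger0_norm ?total_slope_ge0.
rewrite int_lin ?expR_ge0//; try exact: measurable_exp_abs.
by rewrite mul0e adde0; apply: lte_mul_pinfty => //; rewrite lee_fin expR_ge0.
Qed.

Lemma measurable_tau_app : measurable_fun setT (tau : appT -> R).
Proof.
apply: (@measurable_sig_alg _ T).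
  exists [:: (1, [:: o])] => e.
  by rewrite (word_comb_time T0 nd0 ndm nd_le (plY e)).
move=> e; have /andP[t0 t1] := tauT e; rewrite ger0_norm//.
by apply: le_trans t1 _; rewrite lerDr mulr_ge0 ?total_slope_ge0 ?ltW.
Qed.

(** The only slopes on which the path stopped at tau depends. *)
Definition seen_slope e k i := if nd k < tau e then V e k i else 0.

(** The algebra yields V k i times the time spent in the k-th interval before tau;
    the division is harmless, as 0 ^ -1 is multiplied by 0. *)
Lemma measurable_seen_slope k i : (k < m)%N ->
  measurable_fun setT (fun e : appT => seen_slope e k i).
Proof.
move=> km; have [q hq] := word_comb_slope T0 nd0 ndm nd_le i km.
have mVh : measurable_fun setT (fun e : appT => V e k i * ramp nd k (tau e)).
  apply: (@measurable_fun_cvg _ appT _ _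
    (fun n e => pl_integral m nd i (horner (q n)) (V e) (tau e))).
    move=> n; have [C C0 hC] := pl_integral_bound T0 nd0 nd_le i (q n).
    apply: (@measurable_sig_alg _ C).
      have [s hs] := word_comb_pl_integral T0 nd0 ndm nd_le o i (q n).
      by exists s => e; rewrite (hs (V e)).
    move=> e; apply: le_trans (hC (V e) _ (tauT e)) _.
    apply: le_trans (ler_wpM2l C0 (slope_le e i)) _.
    by rewrite lerDl.
  by move=> e _; exact: hq.
have mh : measurable_fun setT (fun e : appT => ramp nd k (tau e)).
  by apply: measurable_funB; apply: measurable_minr => //; exact: measurable_tau_app.
rewrite (_ : (fun e : appT => seen_slope e k i) =
    fun e => V e k i * ramp nd k (tau e) * (ramp nd k (tau e) `^ (- 1))).
  apply: measurable_funM => //; apply: (measurableT_comp (measurable_powR (- 1))).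
  exact: mh.
apply/funext => e; rewrite /seen_slope; case: ltP => [kt|tk]; last first.
  by rewrite (ramp_eq0 nd_le km tk) mulr0 mul0r.
have h0 : 0 < ramp nd k (tau e).
  have := nd_lt km; rewrite /ramp [Num.min _ (nd k)]min_r ?(ltW kt)// => ndk.
  by rewrite subr_gt0 lt_min kt.
by rewrite powR_inv1 ?(ltW h0)// mulfK ?gt_eqF.
Qed.

Section observable.
Variables (Z : pseudoPMetricType R) (Phi : E -> Z).
Hypothesis cPhi : forall e (eps : R), 0 < eps -> exists2 delta : R, 0 < delta &
  forall e', `|tau e - tau e'| < delta ->
    (forall k i, (k < m)%N -> `|seen_slope e k i - seen_slope e' k i| < delta) ->
    ball (Phi e) eps (Phi e').

Lemma measurable_observable_app : measurable_fun setT (Phi : appT -> borel Z).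
Proof.
pose v (e : appT) (j : option ('I_m * 'I_d)) :=
  if j is Some (k, i) then seen_slope e k i else tau e.
apply: (@measurable_fun_borel _ appT _ _ _ v).
  by case=> [[k i]|]; [exact: measurable_seen_slope|exact: measurable_tau_app].
move=> e eps /(cPhi e)[delta delta0 h]; exists delta => // e' ee'; apply: h.
  exact: (ee' None).
by move=> k i km; exact: (ee' (Some (Ordinal km, i))).
Qed.

Lemma measurable_observable : measurable_fun setT (Phi : E -> borel Z).
Proof.
move=> _ B mB; have := measurable_observable_app measurableT mB.
rewrite (measurable_approximable sig_alg_moments sig_alg_cst sig_algD sig_algM).
by case.
Qed.

(** Signature functionals at time tau are dense among the functions of Phi in L^p
    as soon as Phi depends continuously on the time and on the seen slopes. *)
Theorem signature_density (p : R) (f : borel Z -> R) : 1 <= p ->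
  measurable_fun setT f -> (\int[mu]_e (`|f (Phi e)| `^ p)%:E < +oo)%E ->
  forall eps : R, 0 < eps -> exists N (l : seq 'I_d -> R),
    measurable_fun setT (fun e => sig_functional N l (Y e) (tau e)) /\
    (\int[mu]_e (`|f (Phi e) - sig_functional N l (Y e) (tau e)| `^ p)%:E < eps%:E)%E.
Proof.
move=> p1 mf fp eps eps0.
have mfPhi : measurable_fun setT ((fun e => f (Phi e)) : appT -> R).
  exact: (measurableT_comp mf measurable_observable_app).
have [a aa ia] := approximable_Lp sig_alg_moments sig_alg_cst sig_algD sig_algM
  p1 mfPhi fp eps0.
have [ma _] := sig_alg_moments aa.
have [s hs] := aa; have [N [l hl]] := word_comb_sig s; exists N, l.
by split; [under eq_fun do rewrite hl -hs|under eq_integral do rewrite hl -hs].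
Qed.

End observable.
End signature_density.

(** * Exponential moments of Gaussian variables *)

Section gaussian_exponential_moments.
Context {R : realType}.
Implicit Types m s c x : R.
Local Notation leb := (@lebesgue_measure R).

Lemma expR_abs_le c x : expR (c * `|x|) <= expR (c * x) + expR (- c * x).
Proof.
have [x0|x0] := leP 0 x; first by rewrite ger0_norm// lerDl expR_ge0.
by rewrite ltr0_norm// mulrN mulNr lerDr expR_ge0.
Qed.

(** Completing the square: an exponential factor shifts the mean. *)
Lemma normal_pdf_shift m s c x : s != 0 ->
  expR (c * x) * normal_pdf m s x =
  expR (c * m + c ^+ 2 * s ^+ 2 / 2) * normal_pdf (m + c * s ^+ 2) s x.
Proof.
move=> s0; rewrite !normal_pdfE// /normal_fun !(mulrCA (expR _)) -!expRD.
by congr (_ * expR _); field.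
Qed.

(** The density of a normal law agrees almost everywhere with its Radon-Nikodym
    derivative, for which the change of variables holds. *)
Lemma normal_prob_density m s (f : R -> \bar R) : s != 0 ->
  measurable_fun setT f -> (forall x, 0 <= f x)%E ->
  (\int[normal_prob m s]_x f x = \int[leb]_x (f x * (normal_pdf m s x)%:E))%E.
Proof.
move=> s0 mf f0.
have dom := normal_prob_dominates m s.
rewrite -(Radon_Nikodym_SigmaFinite.change_of_variables dom f0 measurableT mf).
apply: ae_eq_integral => //.
- apply: emeasurable_funM => //.
  exact: measurable_int (Radon_Nikodym_SigmaFinite.f_integrable dom).
- apply: emeasurable_funM => //; apply/measurable_EFinP; exact: measurable_normal_pdf.
- have : ae_eq leb setT (Radon_Nikodym_SigmaFinite.f (normal_prob m s) leb)
      (fun x => (normal_pdf m s x)%:E).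
    apply: integral_ae_eq => //.
    + exact: Radon_Nikodym_SigmaFinite.f_integrable.
    + by apply/measurable_EFinP; exact: measurable_normal_pdf.
    + by move=> A _ mA; rewrite -Radon_Nikodym_SigmaFinite.f_integral.
  exact: ae_eqe_mul2l.
Qed.

Lemma normal_exp_moment m s c : s != 0 ->
  (\int[normal_prob m s]_x (expR (c * `|x|))%:E < +oo)%E.
Proof.
move=> s0; have mexp k : measurable_fun setT (fun x => expR (k * x)).
  apply: measurableT_comp; first exact: measurable_expR.
  by apply: measurable_funM => //; exact: measurable_cst.
have mE : measurable_fun setT (fun x => expR (c * `|x|)).
  exact: (@measurable_exp_abs _ _ _ c id).
rewrite normal_prob_density//; last exact/measurable_EFinP.
have mpdf k : measurable_fun setT (normal_pdf k s) by exact: measurable_normal_pdf.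
pose K k := expR (k * m + k ^+ 2 * s ^+ 2 / 2).
under eq_integral do rewrite -EFinM.
apply: (@le_lt_trans _ _ (\int[leb]_x (K c * normal_pdf (m + c * s ^+ 2) s x +
   K (- c) * normal_pdf (m + (- c) * s ^+ 2) s x)%:E)%E).
  apply: int_le => [||x|x].
  - apply: measurable_funM; [exact: mE|exact: mpdf].
  - apply: measurable_funD; (apply: measurable_funM; [exact: measurable_cst|exact: mpdf]).
  - by rewrite mulr_ge0 ?expR_ge0 ?normal_pdf_ge0.
  - rewrite /K -(normal_pdf_shift m c x s0) -(normal_pdf_shift m (- c) x s0) -mulrDl.
    by apply: ler_wpM2r; [exact: normal_pdf_ge0|exact: expR_abs_le].
rewrite int_lin ?expR_ge0//; try exact: mpdf; try exact: normal_pdf_ge0.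
by rewrite !integral_normal_pdf !mule1 -EFinD ltry.
Qed.

Context {dO : measure_display} {Omega : measurableType dO}.
Variable P : probability Omega R.

Lemma gaussian_exp_moments (Y : Omega -> R) : gaussian_var P Y -> has_exp_moments P Y.
Proof.
move=> [mY [m [s law]]]; split => // c.
have mE : measurable_fun setT (fun x : measurableTypeR R => (expR (c * `|x : R|))%:E).
  by apply/measurable_EFinP; exact: (@measurable_exp_abs _ _ _ c id).
have E0 x : (0 <= (expR (c * `|x|))%:E :> \bar R)%E by rewrite lee_fin expR_ge0.
have mY' : measurable_fun setT (Y : Omega -> measurableTypeR R) := mY.
pose mYX := isMeasurableFun.Build _ _ _ _ _ mY'.
pose Y' : {mfun Omega >-> measurableTypeR R} := HB.pack Y mYX.
have -> : (\int[P]_x (expR (c * `|Y x|))%:E = \int[distribution P Y']_y (expR (c * `|y|))%:E)%E.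
  by rewrite ge0_integral_distribution.
move: law; rewrite /gaussian_law; have [_|s0] := eqVneq s 0 => law.
  have -> : (\int[distribution P Y']_y (expR (c * `|y|))%:E =
      \int[@dirac _ (measurableTypeR R) m R]_y (expR (c * `|y|))%:E)%E.
    by apply: eq_measure_integral => A mA _; exact: law.
  by rewrite integral_dirac// diracT mul1e ltry.
have -> : (\int[distribution P Y']_y (expR (c * `|y|))%:E =
    \int[normal_prob m s]_y (expR (c * `|y|))%:E)%E.
  by apply: eq_measure_integral => A mA _; exact: law.
exact: normal_exp_moment.
Qed.

End gaussian_exponential_moments.

(** * Interpolation and Holder estimates *)

Section interpolation.
Context {R : realType} {d : nat}.
Implicit Types (x : R -> 'rV[R]_d) (a t : R) (p : seq R).

(** For k beyond the interval of t the ramp vanishes, and before it the ramp has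
    reached the length of the interval, so that the sum telescopes. *)
Lemma lin_interp_ramp x p a t : path <%R a p -> a <= t ->
  lin_interp x a p t = x a + \sum_(k < size p)
    (ramp (pnode a p) k t / (pnode a p k.+1 - pnode a p k)) *:
      (x (pnode a p k.+1) - x (pnode a p k)).
Proof.
elim: p a => [|b p ih] a /=; first by rewrite big_ord0 addr0.
move=> /andP[ab bp] at_; rewrite big_ord_recl /= {1}/ramp /pnode /= (min_r at_).
have [tb|bt] := leP t b.
  rewrite big1 ?addr0// => k _; rewrite /ramp /=.
  have hk j : b <= nth a (b :: p) j \/ (size p < j)%N.
    case: (leqP j (size p)) => jp; [left|by right].
    have ip : itv_partition b (last b p) p by split.
    rewrite (set_nth_default b) /=; last by rewrite ltnS.
    by apply: (pnode_le ip (k := 0)); rewrite leq0n.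
  rewrite !min_l ?subrr ?mul0r ?scale0r//.
    by case: (hk k) => [/(le_trans tb)//|]; rewrite ltnNge ltnW ?ltn_ord.
  by case: (hk k.+1) => [/(le_trans tb)//|]; rewrite ltnNge ltn_ord.
rewrite divff ?subr_eq0 ?gt_eqF// scale1r addrA [x a + _]addrC subrK.
rewrite (ih b bp (ltW bt)); congr (_ + _); apply: eq_bigr => k _.
rewrite /ramp /= /bump /= ?add1n /pnode /=.
have kp : (k < size p)%N by [].
have kp' : (k < size (b :: p))%N by exact: leqW.
by rewrite !add0n !(set_nth_default a b kp) !(set_nth_default a b kp').
Qed.

End interpolation.

Section holder_estimates.
Context {R : realType} {n : nat}.

Lemma enorm_le_sum (u : 'rV[R]_n) : enorm u <= \sum_i `|u 0 i|.
Proof.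
have S0 : 0 <= \sum_i `|u 0 i| by apply: sumr_ge0.
rewrite -ler_sqr ?nnegrE ?enorm_ge0// sqr_enorm expr2 mulr_suml.
apply: ler_sum => i _; rewrite -normr_id -[u 0 i ^+ 2]ger0_norm ?sqr_ge0// normrX expr2 normr_id.
by apply: ler_wpM2l => //; rewrite (bigD1 i)//= lerDl sumr_ge0.
Qed.

Lemma holder_dist_le (T a D : R) (Y Z : R -> 'rV[R]_n) :
  (forall s t i, 0 <= s -> s < t -> t <= T ->
    `|Y t 0 i - Y s 0 i - (Z t 0 i - Z s 0 i)| <= D * (t - s) `^ a) ->
  (holder_dist T a Y Z <= (n%:R * D)%:E)%E.
Proof.
move=> h; apply: ge_ereal_sup => _ [s [t [s0 [st [tT ->]]]]].
rewrite lee_fin ger0_norm ?subr_ge0 ?(ltW st)// ler_pdivrMr ?powR_gt0 ?subr_gt0//.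
apply: le_trans (enorm_le_sum _) _.
apply: (@le_trans _ _ (\sum_(i < n) D * (t - s) `^ a)).
  by apply: ler_sum => i _; rewrite !mxE; exact: h.
by rewrite sumr_const card_ord -[leLHS]mulr_natl mulrA.
Qed.

End holder_estimates.

Section piecewise_linear_holder.
Context {R : realType}.
Variables (T : R) (m : nat) (nd : nat -> R).
Hypothesis T0 : 0 < T.
Hypothesis nd_le : forall k, (k < m)%N -> nd k <= nd k.+1.

(** Geometric interpolation between the bounds x and y. *)
Lemma min_powR (a x y : R) : 0 <= a -> a < 1 -> 0 < x -> 0 <= y ->
  Num.min x y <= x `^ a * y `^ (1 - a).
Proof.
move=> a0 a1 x0 y0.
have split z : 0 < z -> z = z `^ a * z `^ (1 - a).
  move=> z0; rewrite -powRD; last by apply/implyP => _; rewrite gt_eqF.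
  by rewrite addrC subrK powRr1// ltW.
have [xy|yx] := leP x y.
  rewrite {1}(split x x0) ler_wpM2l ?powR_ge0//.
  by apply: ge0_ler_powR => //; rewrite ?nnegrE ?subr_ge0 ltW.
move: y0; rewrite le_eqVlt => /predU1P[<-|y0]; first by rewrite mulr_ge0 ?powR_ge0.
rewrite {1}(split y y0) ler_wpM2r ?powR_ge0//.
by apply: ge0_ler_powR => //; rewrite ?nnegrE ltW.
Qed.

(** An increment over [s, t] of the difference between a path stopped at tau and
    the same path stopped at tau' is of order
    min (t - s, |tau - tau'|) <= (t - s) ^ a * |tau - tau'| ^ (1 - a);
    the dependence on the slopes is linear. *)
Lemma stopped_holder (a S eps : R) : 0 <= a -> a < 1 -> 0 <= S -> 0 < eps ->
  exists2 delta : R, 0 < delta & forall (z z' : nat -> R) tau tau',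
  \sum_(k < m) `|z k| <= S -> (forall k, (k < m)%N -> `|z k - z' k| < delta) ->
  `|tau - tau'| < delta -> forall s t, 0 <= s -> s < t -> t <= T ->
  `|\sum_(k < m) z k * ramp nd k (Num.min t tau) - \sum_(k < m) z k * ramp nd k (Num.min s tau)
    - (\sum_(k < m) z' k * ramp nd k (Num.min t tau') - \sum_(k < m) z' k * ramp nd k (Num.min s tau'))|
  <= eps * (t - s) `^ a.
Proof.
move=> a0 a1 S0 eps0.
have b0 : 0 < 1 - a by rewrite subr_gt0.
have Tb : 0 < T `^ (1 - a) by rewrite powR_gt0.
have [d1 d10 d1E] : exists2 x, 0 < x & x = eps / 2 / (m.+1%:R * T `^ (1 - a)).
  by eexists; [|reflexivity]; rewrite !divr_gt0// mulr_gt0.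
have [c c0 cE] : exists2 x, 0 < x & x = eps / 2 / (2 * S + 1).
  by eexists; [|reflexivity]; rewrite !divr_gt0// ltr_wpDl// mulr_ge0.
pose d2 := c `^ (1 - a)^-1.
have d20 : 0 < d2 by rewrite powR_gt0.
exists (Num.min d1 d2) => [|z z' tau tau' zS zz' tt' s t s0 st tT]; first by rewrite lt_min d10.
have ts0 : 0 < t - s by rewrite subr_gt0.
have sts : Num.min s tau' <= Num.min t tau' by rewrite le_min ge_min (ltW st)/= ge_min lexx orbT.
have lip1 k r u v : (k < m)%N -> `|ramp nd k (Num.min u r) - ramp nd k (Num.min v r)| <= `|u - v|.
  move=> km; wlog uv : u v / v <= u.
    by move=> h; have [/h//|/ltW/h] := leP v u; rewrite distrC [`|v - u|]distrC.
  have le : Num.min v r <= Num.min u r by rewrite le_min ge_min uv/= ge_min lexx orbT.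
  have /andP[h0 h1] := ramp_mono nd_le km le; have /andP[h2 h3] := min_lip r uv.
  rewrite ger0_norm// ger0_norm ?subr_ge0//; exact: le_trans h1 h3.
have lip2 k u r r' : (k < m)%N -> `|ramp nd k (Num.min u r) - ramp nd k (Num.min u r')| <= `|r - r'|.
  by move=> km; rewrite ![Num.min u _]minC; exact: lip1.
have -> : \sum_(k < m) z k * ramp nd k (Num.min t tau) - \sum_(k < m) z k * ramp nd k (Num.min s tau)
    - (\sum_(k < m) z' k * ramp nd k (Num.min t tau') - \sum_(k < m) z' k * ramp nd k (Num.min s tau'))
  = \sum_(k < m) (z k - z' k) * (ramp nd k (Num.min t tau') - ramp nd k (Num.min s tau')) +
    \sum_(k < m) z k * (ramp nd k (Num.min t tau) - ramp nd k (Num.min s tau) -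
       (ramp nd k (Num.min t tau') - ramp nd k (Num.min s tau'))).
  rewrite -!sumrB -big_split/=; apply: eq_bigr => k _; ring.
rewrite [eps]splitr mulrDl; apply: le_trans (ler_normD _ _) _; apply: lerD.
  apply: le_trans (ler_norm_sum _ _ _) _.
  apply: (@le_trans _ _ (\sum_(k < m) d1 * (T `^ (1 - a) * (t - s) `^ a))).
    apply: ler_sum => k _; have km := ltn_ord k; rewrite normrM.
    apply: ler_pM => //; first by apply: le_trans (ltW (zz' k km)) _; rewrite ge_min lexx.
    apply: le_trans (lip1 k tau' t s km) _; rewrite gtr0_norm//.
    apply: le_trans (_ : _ <= (t - s) `^ (1 - a) * (t - s) `^ a) _.
      rewrite -powRD; last by apply/implyP => _; rewrite gt_eqF.
      by rewrite subrK powRr1// ltW.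
    rewrite ler_wpM2r ?powR_ge0//; apply: ge0_ler_powR; rewrite ?nnegrE ?(ltW b0) ?(ltW ts0) ?(ltW T0)//.
    by rewrite lerBlDr ler_wpDr.
  rewrite sumr_const card_ord -[leLHS]mulr_natl !mulrA ler_wpM2r ?powR_ge0//.
  apply: (@le_trans _ _ (m.+1%:R * d1 * T `^ (1 - a))).
    by rewrite ler_wpM2r ?(ltW Tb)// ler_wpM2r ?(ltW d10)// ler_nat.
  rewrite le_eqVlt; apply/orP; left; apply/eqP; rewrite d1E; move: Tb.
  have M0 : 0 < m.+1%:R :> R by rewrite ltr0n.
  move: M0; move: (m.+1%:R : R) (T `^ (1 - a)) => M B M0 B0.
  by field; rewrite !gt_eqF.
have tauc : `|tau - tau'| `^ (1 - a) <= c.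
  have -> : c = d2 `^ (1 - a) by rewrite /d2 -powRrM mulVf ?gt_eqF// powRr1// ltW.
  apply: ge0_ler_powR; rewrite ?nnegrE ?(ltW b0) ?(ltW d20)//.
  by apply: le_trans (ltW tt') _; rewrite ge_min lexx orbT.
apply: le_trans (ler_norm_sum _ _ _) _.
apply: (@le_trans _ _ (\sum_(k < m) `|z k| * (2 * ((t - s) `^ a * c)))).
  apply: ler_sum => k _; have km := ltn_ord k; rewrite normrM; apply: ler_wpM2l => //.
  apply: (@le_trans _ _ (2 * Num.min (t - s) `|tau - tau'|)); last first.
    rewrite ler_wpM2l//; apply: le_trans (min_powR a0 a1 ts0 (normr_ge0 _)) _.
    by rewrite ler_wpM2l ?powR_ge0.
  have l1 := lip1 k tau t s km; have l2 := lip1 k tau' t s km.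
  have l3 := lip2 k t tau tau' km; have l4 := lip2 k s tau tau' km.
  move: l1 l2 l3 l4; rewrite (gtr0_norm ts0) !ler_norml.
  move=> /andP[? ?] /andP[? ?] /andP[? ?] /andP[? ?].
  by have [? | ?] := leP (t - s) `|tau - tau'|; apply/andP; split; lra.
rewrite -mulr_suml; apply: le_trans (ler_wpM2r _ zS) _.
  by rewrite !mulr_ge0 ?powR_ge0 ?(ltW c0).
rewrite [(t - s) `^ a * c]mulrC !mulrA ler_wpM2r ?powR_ge0//.
rewrite cE mulrA ler_pdivrMr ?ltr_wpDl ?mulr_ge0//.
have : 0 <= eps * S by rewrite mulr_ge0// ltW.
by nra.
Qed.

End piecewise_linear_holder.

(** * Density for the interpolated process *)

Section exp_moments_closure.
Context {dE : measure_display} {E : measurableType dE} {R : realType}.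
Variable mu : {measure set E -> \bar R}.
Implicit Types h g : E -> R.

Lemma has_exp_momentsD h g : has_exp_moments mu h -> has_exp_moments mu g ->
  has_exp_moments mu (fun x => h x + g x).
Proof.
move=> [mh ih] [mg ig]; split; first exact: measurable_funD.
move=> c; apply: (@le_lt_trans _ _ (\int[mu]_x (1 * expR (2 * `|c| * `|h x|) +
   1 * expR (2 * `|c| * `|g x|))%:E)%E).
  apply: int_le => [||x|x].
  - exact/(@measurable_exp_abs _ _ _ _ (fun x => h x + g x))/measurable_funD.
  - by apply: measurable_funD; apply: measurable_funM => //; exact: measurable_exp_abs.
  - exact: expR_ge0.
  - rewrite !mul1r; set a := `|h x|; set b := `|g x|.
    have cab : c * `|h x + g x| <= `|c| * (a + b).
      apply: le_trans (ler_wpM2r _ (ler_norm c)) _ => //.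
      by rewrite ler_wpM2l// ler_normD.
    have cmax : `|c| * (a + b) <= 2 * `|c| * Num.max a b.
      rewrite -mulrA mulrCA ler_wpM2l// mulr2n mulrDl mul1r.
      by rewrite lerD// le_max lexx ?orbT.
    apply: (@le_trans _ _ (expR (2 * `|c| * Num.max a b))).
      by rewrite ler_expR (le_trans cab).
    by have [_|_] := leP a b; rewrite ?lerDl ?lerDr expR_ge0.
rewrite int_lin//; try exact: measurable_exp_abs; try (by move=> x; exact: expR_ge0).
by rewrite !mul1e lte_add_pinfty.
Qed.

Lemma has_exp_moments_norm h : has_exp_moments mu h -> has_exp_moments mu (fun x => `|h x|).
Proof.
move=> [mh ih]; split; first exact: measurableT_comp.
by move=> c; under eq_integral do rewrite normr_id; exact: ih.
Qed.

Lemma has_exp_moments_cst (c : R) : (mu setT < +oo)%E -> has_exp_moments mu (cst c).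
Proof.
move=> muT; split; first exact: measurable_cst.
move=> k; rewrite (_ : (\int[mu]_x _)%E = (expR (k * `|c|))%:E * mu setT)%E.
  by apply: lte_mul_pinfty => //; rewrite lee_fin expR_ge0.
by rewrite -integral_cst.
Qed.

Lemma has_exp_moments_sum (I : Type) (r : seq I) (F : I -> E -> R) :
  (mu setT < +oo)%E -> (forall i, has_exp_moments mu (F i)) ->
  has_exp_moments mu (fun x => \sum_(i <- r) F i x).
Proof.
move=> muT hF; elim: r => [|i r ih].
  by under eq_fun do rewrite big_nil; exact: has_exp_moments_cst.
by under eq_fun do rewrite big_cons; exact: has_exp_momentsD.
Qed.

End exp_moments_closure.

Section slopes.
Context {R : realType} {d : nat}.

(** Coordinate 0 of the path is time, whose slope is 1. *)
Definition pl_slope (p : seq R) (x : R -> 'rV[R]_d) (k : nat) (i : 'I_d.+1) : R :=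
  if unlift ord0 i is Some j
  then (x (pnode 0 p k.+1) 0 j - x (pnode 0 p k) 0 j) / (pnode 0 p k.+1 - pnode 0 p k)
  else 1.

Lemma lin_path_pl (T : R) (p : seq R) (x : R -> 'rV[R]_d) :
  itv_partition 0 T p -> x 0 = 0 ->
  pl_path T (size p) (pnode 0 p) (pl_slope p x) (lin_path T p x).
Proof.
move=> ip x0 t tT i; have /andP[t0 tT'] := tT.
rewrite /lin_path patchE mem_set; last by rewrite /= in_itv.
rewrite /time_ext mxE /pl_slope; case: unliftP => [j _|_].
  rewrite lin_interp_ramp ?x0 ?add0r//; last by case: ip.
  rewrite summxE; apply: eq_bigr => k _; rewrite !mxE; ring.
under eq_bigr do rewrite mul1r.
by rewrite (sum_ramp _ (pnode_last ip) tT).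
Qed.

Context {dO : measure_display} {Omega : measurableType dO}.
Variable P : probability Omega R.
Variables (T : R) (X : R -> Omega -> 'rV[R]_d) (p : seq R).
Hypotheses (gX : gaussian_process P T X) (ip : itv_partition 0 T p).

Lemma pnode_itv k : 0 <= pnode 0 p k <= T.
Proof.
have T0 : 0 <= T := itv_partition_le ip.
have [kp|pk] := leqP k (size p); last by rewrite /pnode nth_default// lexx.
apply/andP; split; first by apply: (pnode_le ip (k := 0)); rewrite leq0n.
by rewrite -(pnode_last ip); apply: (pnode_le ip); rewrite kp leqnn.
Qed.

(** A slope is a combination of two values of the process, hence Gaussian. *)
Lemma slope_exp_moments k i :
  has_exp_moments P (fun w => pl_slope p (fun t => X t w) k i).
Proof.
rewrite /pl_slope; case: unlift => [j|]; last first.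
  apply: has_exp_moments_cst; apply: (@le_lt_trans _ _ 1%E); last exact: ltry.
  exact: probability_le1.
pose t (l : 'I_2) := pnode 0 p (k + l).
have tT l : 0 <= t l <= T by exact: pnode_itv.
pose c (l : 'I_2) : R := (if val l == 0%N then -1 else 1) / (pnode 0 p k.+1 - pnode 0 p k).
have := gX c (fun=> j) tT; move=> /gaussian_exp_moments.
congr has_exp_moments; apply/funext => w; rewrite !big_ord_recl big_ord0 addr0 /c /t /=.
by rewrite /bump/= addn0 addn1; ring.
Qed.

End slopes.

Section densities.
Context {R : realType} {d : nat}.
Context {dO : measure_display} {Omega : measurableType dO}.
Variable P : probability Omega R.
Variables (T : {posnum R}) (a q : R) (X : R -> Omega -> 'rV[R]_d) (p : seq R).
Hypotheses (gX : gaussian_process P T%:num X) (ip : itv_partition 0 T%:num p).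
Hypothesis X0 : forall w, X 0 w = 0.
Hypotheses (a0 : 0 <= a) (a1 : a < 1) (q1 : 1 <= q).

Let T0 : 0 < T%:num. Proof. by []. Qed.
Let m := size p.
Let nd := pnode 0 p.
Let V (w : Omega) := pl_slope p (fun t => X t w).
Let Y (w : Omega) := path_of (Xhat T a p X0 w).

Let nd0 : nd 0%N = 0. Proof. by []. Qed.
Let ndm : nd m = T%:num. Proof. exact: pnode_last ip. Qed.
Let nd_lt k : (k < m)%N -> nd k < nd k.+1. Proof. exact: pnode_ltS ip. Qed.
Let nd_le k : (k < m)%N -> nd k <= nd k.+1. Proof. by move=> /nd_lt/ltW. Qed.

Let plY w : pl_path T%:num m nd (V w) (Y w).
Proof. exact: lin_path_pl ip (X0 w). Qed.

Let mV k i : measurable_fun setT (fun w => V w k i).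
Proof. by have [] := slope_exp_moments gX ip k i. Qed.

Let tV w : time_coord ord0 (V w).
Proof. by move=> k; rewrite /V /pl_slope unlift_none. Qed.

Let exp_slope : has_exp_moments P (total_slope m V).
Proof.
have P1 : (P setT < +oo)%E.
  by apply: (@le_lt_trans _ _ 1%E); [exact: probability_le1|exact: ltry].
apply: has_exp_moments_sum => // k; apply: has_exp_moments_sum => // i.
exact: has_exp_moments_norm (slope_exp_moments gX ip k i).
Qed.

(** A ramp that starts after tau vanishes along the path stopped at tau. *)
Lemma stopped_path (dE : measure_display) (E : measurableType dE)
    (v : E -> nat -> 'I_d.+1 -> R) (tau : E -> R) e i u :
  \sum_(k < m) v e k i * ramp nd k (Num.min u (tau e)) =
  \sum_(k < m) seen_slope nd tau v e k i * ramp nd k (Num.min u (tau e)).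
Proof.
apply: eq_bigr => k _; rewrite /seen_slope; case: ltP => // tk.
by rewrite (ramp_eq0 nd_le (ltn_ord k)) ?mulr0// ge_min tk orbT.
Qed.

Lemma seen_slope_le (dE : measure_display) (E : measurableType dE)
    (v : E -> nat -> 'I_d.+1 -> R) (tau : E -> R) e i :
  \sum_(k < m) `|seen_slope nd tau v e k i| <= total_slope m v e.
Proof.
apply: ler_sum => k _; rewrite (bigD1 i)//= /seen_slope.
apply: le_trans (_ : _ <= `|v e k i|) _; first by case: ifP => // _; rewrite normr0.
by rewrite lerDl sumr_ge0.
Qed.

Theorem terminal_density (f : borel (Chat T a p 0) -> R) :
  measurable_fun setT f ->
  (\int[P]_w (`|f (Xhat T a p X0 w)| `^ q)%:E < +oo)%E ->
  forall eps : R, 0 < eps -> exists N (l : seq 'I_d.+1 -> R),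
    (\int[P]_w (`|f (Xhat T a p X0 w) -
       sig_functional N l (path_of (Xhat T a p X0 w)) T%:num| `^ q)%:E < eps%:E)%E.
Proof.
move=> mf fq eps eps0.
have tauT (w : Omega) : 0 <= cst T%:num w <= T%:num by rewrite /= lexx ge0.
have [|N [l [_ h]]] := @signature_density _ _ _ _ P T%:num m nd ord0 T0 nd0 ndm nd_lt
  (cst T%:num) V Y (measurable_cst _) tauT mV tV plY exp_slope
  (Chat T a p 0) (fun w => Xhat T a p X0 w) _ q f q1 mf fq eps eps0; last by exists N, l.
move=> w e e0.
pose e' := e / 2 / d.+1%:R.
have e'0 : 0 < e' by rewrite !divr_gt0.
have [delta delta0 h] := stopped_holder T0 nd_le a0 a1 (total_slope_ge0 m V w) e'0.
exists delta => // w' _ seen; rewrite /ball/= /Chat_dist.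
apply: (@le_lt_trans _ _ (d.+1%:R * e')%:E); last first.
  by rewrite lte_fin /e' mulrC divfK// ltr_pdivrMr// ltr_pMr// ltr1n.
apply: holder_dist_le => s t i s0 st tT.
have sT : s <= T%:num by rewrite (le_trans (ltW st)).
have YE w0 u : 0 <= u -> u <= T%:num -> Y w0 u 0 i =
    \sum_(k < m) seen_slope nd (cst T%:num) V w0 k i * ramp nd k (Num.min u T%:num).
  move=> u0 uT; rewrite -(stopped_path V (cst T%:num) w0 i u) /= (min_l uT).
  by apply: plY; rewrite u0.
have t0 : 0 <= t by rewrite (le_trans s0)// ltW.
rewrite -/(Y w) -/(Y w') !YE//.
apply: (h (fun k => seen_slope nd (cst T%:num) V w k i)
  (fun k => seen_slope nd (cst T%:num) V w' k i)) => //.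
- exact: seen_slope_le.
- by move=> k km; exact: seen.
- by rewrite subrr normr0.
Qed.

Notation leb := (@lebesgue_measure R).

Let I0T : set (measurableTypeR R) := `[0%R, T%:num].
Let mI0T : measurable I0T. Proof. exact: measurable_itv. Qed.
Let fin_I0T : (leb I0T < +oo)%E.
Proof. by rewrite /I0T lebesgue_measure_itv/=; case: ifP => _; rewrite ltry. Qed.
Let dt : {finite_measure set (measurableTypeR R) -> \bar R} := mfrestr mI0T fin_I0T.

Let E := (measurableTypeR R * Omega)%type.
Let tau (e : E) := clamp T e.1.

Lemma clamp_id t : 0 <= t <= T%:num -> clamp T t = t.
Proof. by move=> /andP[t0 tT]; rewrite /clamp (max_idPl t0) (min_idPl tT). Qed.

Let tauT e : 0 <= tau e <= T%:num.
Proof. by have := clamp_itv T e.1; rewrite in_itv. Qed.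

Let measurable_tau : measurable_fun setT tau.
Proof.
have m1 : measurable_fun setT (fun e : E => e.1 : R) by exact: measurable_fst.
by apply: measurable_minr; [apply: measurable_maxr => //|]; exact: measurable_cst.
Qed.

Let measurable_snd_comp (h : Omega -> R) : measurable_fun setT h ->
  measurable_fun setT (fun e : E => h e.2).
Proof. by move=> mh; apply: measurableT_comp mh _; exact: measurable_snd. Qed.

Lemma has_exp_moments_snd (h : Omega -> R) : has_exp_moments P h ->
  has_exp_moments (dt \x P)%E (fun e : E => h e.2).
Proof.
move=> [mh ih]; split; first exact: measurable_snd_comp.
move=> c; pose f (e : E) := (expR (c * `|h e.2|))%:E.
have mf : measurable_fun setT f.
  apply/measurable_EFinP; apply: (@measurable_exp_abs _ _ _ c (fun e : E => h e.2)).
  exact: measurable_snd_comp.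
have f0 e : (0 <= f e)%E by rewrite lee_fin expR_ge0.
have i0 : (0 <= \int[P]_w (expR (c * `|h w|))%:E)%E.
  by apply: integral_ge0 => w _; rewrite lee_fin expR_ge0.
change (\int[dt \x P]_e f e < +oo)%E; rewrite fubini_tonelli1// /fubini_F /f /= integral_cst//.
by apply: lte_mul_pinfty => //; [rewrite ge0_fin_numE ?ih|exact: fin_num_fun_lty].
Qed.

(** Reconciles the restricted measure with the integral over [0, T]. *)
Lemma integral_dt (g : measurableTypeR R -> \bar R) : measurable_fun setT g ->
  (forall t, 0 <= g t)%E ->
  (\int[dt]_t g t = \int[leb]_(t in I0T) g t)%E.
Proof.
move=> mg g0; have dtC : dt (~` I0T) = 0%E by rewrite /= /mfrestr /mrestr setICl measure0.
rewrite (ge0_negligible_integral (measurableC mI0T) measurableT mg (fun t _ => g0 t) dtC).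
rewrite setTD setCK; apply: eq_measure_integral => A mA AI.
by rewrite /= /mfrestr /mrestr setIidl.
Qed.

Let Phi (e : E) : Lambda T a p 0 := phi (e.1, Xhat T a p X0 e.2).

Lemma frozen_Phi e u i : 0 <= u ->
  frozen (stopped_of (Phi e)) u 0 (lift ord0 i) =
  \sum_(k < m) seen_slope nd tau (fun e => V e.2) e k (lift ord0 i) *
    ramp nd k (Num.min u (tau e)).
Proof.
move=> u0; have /andP[t0 tT] := tauT e.
have v0 : 0 <= Num.min u (tau e) by rewrite le_min u0.
have vt : Num.min u (tau e) <= tau e by rewrite ge_min lexx orbT.
rewrite /frozen /time_ext mxE liftK /space_part mxE /= patchE mem_set; last first.
  by rewrite /= in_itv/= v0.
rewrite -stopped_path -(plY e.2) ?v0 ?(le_trans vt)//.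
Qed.

Lemma frozen_Phi_time e u : frozen (stopped_of (Phi e)) u 0 ord0 = u.
Proof. by rewrite /frozen /time_ext mxE unlift_none. Qed.

(** The law of the stopped path is the image under Phi of the product of dt and
    the probability, and Fubini's theorem restores the order of integration. *)
Theorem stopped_density (f : borel (Lambda T a p 0) -> R) :
  in_Lp (law_stopped T a p P X0) q f ->
  forall eps : R, 0 < eps -> exists N (l : seq 'I_d.+1 -> R),
    (\int[P]_w \int[leb]_(t in `[0%R, T%:num])
      (`|f (phi (t, Xhat T a p X0 w)) -
         sig_functional N l (path_of (Xhat T a p X0 w)) t| `^ q)%:E < eps%:E)%E.
Proof.
move=> [mf fq] eps eps0.
have mV2 k i : measurable_fun setT (fun e : E => V e.2 k i).
  exact: (@measurable_snd_comp (fun w => V w k i)).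
have exp2 : has_exp_moments (dt \x P)%E (total_slope m (fun e : E => V e.2)).
  exact: has_exp_moments_snd exp_slope.
have cPhi e (r : R) : 0 < r -> exists2 delta : R, 0 < delta & forall e',
    `|tau e - tau e'| < delta ->
    (forall k i, (k < m)%N -> `|seen_slope nd tau (fun e => V e.2) e k i -
       seen_slope nd tau (fun e => V e.2) e' k i| < delta) ->
    ball (Phi e) r (Phi e').
  move=> e0; pose r' := r / 2 / d.+1%:R.
  have r'0 : 0 < r' by rewrite !divr_gt0.
  have [delta delta0 h] := stopped_holder T0 nd_le a0 a1 (total_slope_ge0 m (fun e => V e.2) e) r'0.
  exists (Num.min delta (r / 2)) => [|e' ee' seen]; first by rewrite lt_min delta0 divr_gt0.
  rewrite /ball/= /Lambda_dist.
  apply: (@le_lt_trans _ _ (`|tau e - tau e'| + r / 2)%:E); last first.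
    by rewrite lte_fin [ltRHS]splitr ltrD2r (lt_le_trans ee')// ge_min lexx orbT.
  rewrite EFinD; apply: leeD => //.
  have -> : r / 2 = d.+1%:R * r' by rewrite /r' [RHS]mulrC divfK.
  apply: holder_dist_le => s t i s0 st tT.
  have t0 : 0 <= t by rewrite (le_trans s0)// ltW.
  case: (unliftP ord0 i) => [j|] ->; last first.
    rewrite !frozen_Phi_time subrr normr0 mulr_ge0 ?powR_ge0//; exact: ltW.
  rewrite !frozen_Phi//.
  apply: (h (fun k => seen_slope nd tau (fun e => V e.2) e k (lift ord0 j))
    (fun k => seen_slope nd tau (fun e => V e.2) e' k (lift ord0 j))) => //.
  - exact: seen_slope_le.
  - by move=> k km; apply: lt_le_trans (seen k _ km) _; rewrite ge_min lexx.
  - by apply: lt_le_trans ee' _; rewrite ge_min lexx.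
have mPhi : measurable_fun setT (Phi : E -> borel (Lambda T a p 0)).
  exact: (measurable_observable T0 nd0 ndm nd_lt measurable_tau tauT mV2
    (fun e => tV e.2) (fun e => plY e.2) exp2 cPhi).
have mpow (h : E -> R) : measurable_fun setT h -> measurable_fun setT (fun x => (`|h x| `^ q)%:E).
  move=> mh; apply/measurable_EFinP; apply: (measurableT_comp (measurable_powR q)).
  exact: measurableT_comp.
have fPhi : (\int[dt \x P]_e (`|f (Phi e)| `^ q)%:E < +oo)%E.
  have law : law_stopped T a p P X0 = pushforward (dt \x P)%E (Phi : E -> borel (Lambda T a p 0)).
    by [].
  have := fq; rewrite law ge0_integral_pushforward//.
  apply/measurable_EFinP; apply: (measurableT_comp (measurable_powR q)).
  exact: measurableT_comp.
have [N [l [ms h]]] := signature_density T0 nd0 ndm nd_lt measurable_tau tauT mV2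
  (fun e => tV e.2) (fun e => plY e.2) exp2 cPhi q1 mf fPhi eps0.
exists N, l.
pose g (e : E) := (`|f (Phi e) - sig_functional N l (Y e.2) (tau e)| `^ q)%:E.
have mg : measurable_fun setT g.
  apply: mpow; apply: measurable_funB => //; exact: measurableT_comp mf mPhi.
have g0 e : (0 <= g e)%E by rewrite lee_fin powR_ge0.
have e2 := @fubini_tonelli2 _ _ _ _ R dt P g mg g0.
have e3 : (\int[P]_w \int[leb]_(t in `[0%R, T%:num])
      (`|f (phi (t, Xhat T a p X0 w)) -
         sig_functional N l (path_of (Xhat T a p X0 w)) t| `^ q)%:E =
   \int[P]_w fubini_G dt g w)%E.
  apply: eq_integral => w _.
  have mgw : measurable_fun setT (fun t => g (t, w)).
    by apply: measurableT_comp mg _; exact: measurable_pair2.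
  rewrite /fubini_G (integral_dt mgw (fun t => g0 (t, w))).
  apply: eq_integral => t; rewrite inE /I0T/= in_itv/= => tT.
  by rewrite /g /Phi /tau /= clamp_id.
by rewrite e3 -e2.
Qed.

End densities.

Theorem proposition4p1 (R : realType) (d : nat) (hd : (0 < d)%N)
    (T : {posnum R}) (p rho alpha alpha' M : R)
    (hp : 1 <= p) (hrho : 1 <= rho < 2)
    (halpha : 1 / 4 < alpha < 1 / (2 * rho)) (halpha' : 0 <= alpha' < alpha)
    (dO : measure_display) (Omega : measurableType dO)
    (P : probability Omega R) (X : R -> Omega -> 'rV[R]_d)
    (hcont : forall w,
      {within `[0, T%:num], continuous (fun t => X t w)})
    (hgauss : gaussian_process P T%:num X)
    (hcentred : centred_process P T%:num X)
    (hindep : independent_components P T%:num X)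
    (hX0 : forall w, X 0 w = 0)
    (hvar : forall (i : 'I_d) (s t : R), 0 <= s -> s <= t -> t <= T%:num ->
      (variation2 P rho (fun u w => X u w 0%R i) s t s t
         <= (M * `|t - s| `^ rho^-1)%:E)%E)
    (pi_ : nat -> seq R)
    (hpi : forall n, itv_partition 0 T%:num (pi_ n))
    (hnested : forall n, {subset pi_ n <= pi_ n.+1})
    (hmesh : mesh 0 (pi_ n) @[n --> \oo] --> 0)
    (n : nat) :
  (forall f : borel (Chat T alpha' (pi_ n) 0) -> R,
     measurable_fun setT f ->
     (fun w => f (Xhat T alpha' (pi_ n) hX0 w)) \in Lfun P p%:E ->
     forall eps : R, 0 < eps ->
     exists (N : nat) (l : seq 'I_d.+1 -> R),
       (\int[P]_w
          (`|f (Xhat T alpha' (pi_ n) hX0 w) -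
             sig_functional N l (path_of (Xhat T alpha' (pi_ n) hX0 w)) T%:num|
             `^ p)%:E < (eps `^ p)%:E)%E) /\
  (forall f : borel (Lambda T alpha' (pi_ n) 0) -> R,
     in_Lp (law_stopped T alpha' (pi_ n) P hX0) p f ->
     forall eps : R, 0 < eps ->
     exists (N : nat) (l : seq 'I_d.+1 -> R),
       (\int[P]_w \int[lebesgue_measure]_(t in `[0%R, T%:num])
          (`|f (phi (t, Xhat T alpha' (pi_ n) hX0 w)) -
             sig_functional N l (path_of (Xhat T alpha' (pi_ n) hX0 w)) t|
             `^ p)%:E < (eps `^ p)%:E)%E).
Proof.
have rho0 : 0 < rho by lra.
have alpha1 : alpha < 1.
  have /andP[_ h] := halpha; apply: (lt_le_trans h).
  by rewrite ler_pdivrMr ?mul1r; lra.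
have a0 : 0 <= alpha' by lra.
have a1 : alpha' < 1 by lra.
split => [f mf fq|f fq] eps eps0.
- apply: (@terminal_density _ _ _ _ P T alpha' p X (pi_ n)) => //; last by rewrite powR_gt0.
  have /integrableP[_] := Lfun_integrable hp fq.
  by under eq_integral do rewrite /= ger0_norm ?powR_ge0//.
- by apply: (@stopped_density _ _ _ _ P T alpha' p X (pi_ n)) => //; rewrite powR_gt0.
Qed.
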